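(* Let $\Gamma$ be a finite, compact metric graph with vertex set $V$, let $v_1, v_2$ be two distinct vertices of $\Gamma$ and let $H$ be the Laplacian in $L^2(\Gamma)$ subject to arbitrary local, self-adjoint vertex conditions at each vertex $v \in V \setminus \{v_1, v_2\}$, and having at each of the vertices $v_1$ and $v_2$ conditions either of type II(a) or II(b) or III(a) (not necessarily the same type at $v_1$ and $v_2$). Let $\widetilde\Gamma$ be the graph obtained from $\Gamma$ by adding an extra edge of an arbitrary, finite length connecting $v_1$ and $v_2$. Moreover, let $\widetilde H$ be the Laplacian in $L^2(\widetilde\Gamma)$ having the same vertex conditions as $H$ at all $v \in V \setminus \{v_1, v_2\}$ and with the natural extension of the vertex conditions for $H$ at $v_1$ and $v_2$. Then $$\lambda_k(\widetilde H) \leq \lambda_k(H)$$ holds for all $k \in \mathbb{N}$ (with $\mathbb{N} = \{1,2,\dots\}$).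
   Context: Metric graphs. A finite, compact metric graph $\Gamma$ consists of a finite vertex set $V$, a finite edge set $E$ (loops and multiple edges are allowed) and a length function $L : E \to (0,\infty)$. Each edge $e$ is identified with the interval $[0, L(e)]$; the endpoint $0$ is attached to the initial vertex of $e$ and the endpoint $L(e)$ to its terminal vertex (these coincide if $e$ is a loop). For $v \in V$, $E_{v,\mathrm{i}}$ (resp. $E_{v,\mathrm{t}}$) is the set of edges with initial (resp. terminal) vertex $v$, and $\deg(v) = |E_{v,\mathrm{i}}| + |E_{v,\mathrm{t}}|$. One sets $L^2(\Gamma) = \bigoplus_{e \in E} L^2(0,L(e))$ and $\widetilde H^k(\Gamma) = \bigoplus_{e\in E} H^k(0,L(e))$; $f_e$ denotes the restriction of $f$ to $e$. Boundary vectors. For $v \in V$ fix enumerations $e_1,\dots,e_l$ of $E_{v,\mathrm{i}}$ and $e_{l+1},\dots,e_m$ of $E_{v,\mathrm{t}}$, $m = \deg(v)$, and put $F(v) = (f_{e_1}(0),\dots,f_{e_l}(0), f_{e_{l+1}}(L(e_{l+1})),\dots,f_{e_m}(L(e_m)))^\top$ and $F'(v) = (f'_{e_1}(0),\dots,f'_{e_l}(0), -f'_{e_{l+1}}(L(e_{l+1})),\dots,-f'_{e_m}(L(e_m)))^\top$, with components $F_j(v)$, $F_j'(v)$. Operators. Local, self-adjoint vertex conditions at $v$ are given by orthogonal projections $P_{v,\mathrm D}, P_{v,\mathrm N}, P_{v,\mathrm R}$ in $\mathbb{C}^{\deg(v)}$ with mutually orthogonal ranges and sum $I$, and a self-adjoint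 invertible operator $\Lambda_v$ in $\operatorname{ran} P_{v,\mathrm R}$; the conditions read $P_{v,\mathrm D}F(v) = 0$, $P_{v,\mathrm N}F'(v) = 0$, $P_{v,\mathrm R}F'(v) = \Lambda_v P_{v,\mathrm R}F(v)$. The Laplacian with such conditions at every vertex is the self-adjoint operator $H$ in $L^2(\Gamma)$ with $(Hf)_e = -f_e''$ for $e\in E$, whose domain consists of all $f \in \widetilde H^2(\Gamma)$ satisfying the conditions at each $v \in V$. Its spectrum is purely discrete and bounded from below; $\lambda_1(H) \le \lambda_2(H) \le \dots$ denote its eigenvalues in non-decreasing order, counted with multiplicities. Types of conditions at $v$. Let $d = \deg(v)$, let $\mathcal{P}_d$ be the orthogonal projection in $\mathbb{C}^d$ onto $\operatorname{span}\{(1,\dots,1)^\top\}$ and $\mathcal{Q}_d = I - \mathcal{P}_d$. - Type II(a) (anti-Kirchhoff): $P_{v,\mathrm N} = \mathcal{Q}_d$, $P_{v,\mathrm D} = \mathcal{P}_d$, $P_{v,\mathrm R} = 0$; i.e. all components of $F'(v)$ are equal and $\sum_{j=1}^d F_j(v) = 0$. - Type II(b) ($\delta'$-type): $P_{v,\mathrm N} = \mathcal{Q}_d$, $P_{v,\mathrm D} = 0$, $P_{v,\mathrm R} = \mathcal{P}_d$, $\Lambda_v$ = multiplication by $d/\beta_v$ with real $\beta_v \ne 0$; i.e. all components of $F'(v)$ are equal, to $f'(v)$ say, and $\sum_{j=1}^d F_j(v) = \beta_v f'(v)$. - Type III(a): $P_{v,\mathrm R} = \mathcal{Q}_d$, $P_{v,\mathrm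 D} = \mathcal{P}_d$, $P_{v,\mathrm N} = 0$, $\Lambda_v$ = multiplication by a real $C_v \ne 0$; i.e. $\sum_{j=1}^d F_j(v) = 0$ and $F_j'(v) - F_k'(v) = C_v(F_j(v) - F_k(v))$ for all $j,k$. Natural extension. When the degree of $v$ increases from $d$ to $\widetilde d > d$, the natural extension of a condition of one of these types is the condition of the same type for degree $\widetilde d$ (replace $\mathcal{P}_d, \mathcal{Q}_d$ by $\mathcal{P}_{\widetilde d}, \mathcal{Q}_{\widetilde d}$) with the same interaction strength, i.e. the constant is $\widetilde d/\beta_v$ in case II(b) and $C_v$ in case III(a). *)

(* Defs.v *)
From HB Require Import structures.
From mathcomp Require Import all_boot all_order all_algebra spectral.
From mathcomp Require Import all_classical all_reals all_analysis.
From mathcomp Require Import complex ring.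

Set Implicit Arguments.
Unset Strict Implicit.
Unset Printing Implicit Defensive.
Import Order.TTheory GRing.Theory Num.Theory.
Import numFieldNormedType.Exports.

#[global] Open Scope classical_set_scope.
#[global] Open Scope ring_scope.
#[global] Open Scope complex_scope.
#[global] Open Scope sesquilinear_scope.

Record metric_graph (R : realType) := MetricGraph {
  vert : finType;
  edge : finType;
  init : edge -> vert;
  term : edge -> vert;
  len : edge -> R;
  len_gt0 : forall e, 0 < len e
}.

Section Graph.
Variables (R : realType) (G : metric_graph R).

(* [inl e] is the end of [e] at 0, [inr e] its end at [len e]; a loop has both
   ends at the same vertex.  [enum] lists all [inl]s before all [inr]s. *)
Definition end_vert (h : edge G + edge G) : vert G :=
  match h with inl e => init e | inr e => term e end.

Definition ends (v : vert G) : {set edge G + edge G} :=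
  [set h | end_vert h == v]%SET.

Definition deg (v : vert G) : nat := #|ends v|.

Lemma enum_ends v :
  enum (ends v) = [seq inl e | e <- enum [pred e : edge G | init e == v]] ++
                  [seq inr e | e <- enum [pred e : edge G | term e == v]].
Proof.
rewrite /enum_mem; have -> : Finite.enum (edge G + edge G)%type =
    [seq inl e | e <- Finite.enum (edge G)] ++
    [seq inr e | e <- Finite.enum (edge G)] by rewrite [in LHS]unlock.
rewrite filter_cat !filter_map; congr cat; apply: congr1;
  by apply: eq_filter => e /=; rewrite !inE.
Qed.

Lemma degE v :
  deg v = (#|[pred e : edge G | init e == v]| + #|[pred e : edge G | term e == v]|)%N.
Proof. by rewrite /deg !cardE enum_ends size_cat !size_map. Qed.

(* functions on G; the values of [f e] outside [0, len e] are irrelevant *)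
Definition gfun := edge G -> R -> R[i].

Definition bval (f : gfun) (h : edge G + edge G) : R[i] :=
  match h with inl e => f e 0 | inr e => f e (len e) end.

Definition bder (f' : gfun) (h : edge G + edge G) : R[i] :=
  match h with inl e => f' e 0 | inr e => - f' e (len e) end.

Definition bvec (f : gfun) (v : vert G) : 'cV[R[i]]_(deg v) :=
  \col_j bval f (enum_val j).

Definition bvec' (f' : gfun) (v : vert G) : 'cV[R[i]]_(deg v) :=
  \col_j bder f' (enum_val j).

End Graph.

Section VertexConditions.
Variable R : realType.

(* [cL] is the operator on ran [cR], extended by 0 to the complement *)
Record vcond (n : nat) := VCond {
  cD : 'M[R[i]]_n;
  cN : 'M[R[i]]_n;
  cR : 'M[R[i]]_n;
  cL : 'M[R[i]]_n
}.

Definition orth_proj n (P : 'M[R[i]]_n) : Prop := P *m P = P /\ P ^t* = P.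

Record selfadjoint_vcond n (c : vcond n) : Prop := SelfadjointVCond {
  projD : orth_proj (cD c);
  projN : orth_proj (cN c);
  projR : orth_proj (cR c);
  orthDN : cD c *m cN c = 0;
  orthDR : cD c *m cR c = 0;
  orthNR : cN c *m cR c = 0;
  projDNR : cD c + cN c + cR c = 1%:M;
  cL_ran : cR c *m cL c *m cR c = cL c;
  cL_herm : (cL c) ^t* = cL c;
  cL_inv : exists M : 'M[R[i]]_n,
    [/\ cR c *m M *m cR c = M, cL c *m M = cR c & M *m cL c = cR c]
}.

Definition vsat n (c : vcond n) (F F' : 'cV[R[i]]_n) : Prop :=
  [/\ cD c *m F = 0, cN c *m F' = 0 & cR c *m F' = cL c *m (cR c *m F)].

Definition cast_vcond n m (e : n = m) (c : vcond n) : vcond m :=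
  VCond (castmx (e, e) (cD c)) (castmx (e, e) (cN c))
        (castmx (e, e) (cR c)) (castmx (e, e) (cL c)).

Definition Pmx d : 'M[R[i]]_d := const_mx (d%:R^-1).
Definition Qmx d : 'M[R[i]]_d := 1%:M - Pmx d.

(* anti-Kirchhoff, delta' and the conditions with
   sum_j F_j = 0 and F'_j - F'_k = C (F_j - F_k) *)
Inductive vtype :=
  | TypeIIa
  | TypeIIb (beta : R) of beta != 0
  | TypeIIIa (C : R) of C != 0.

Definition vtype_cond (t : vtype) (d : nat) : vcond d :=
  match t with
  | TypeIIa => VCond (Pmx d) (Qmx d) 0 0
  | TypeIIb beta _ => VCond 0 (Qmx d) (Pmx d) ((d%:R / beta)%:C *: Pmx d)
  | TypeIIIa C _ => VCond (Pmx d) 0 (Qmx d) (C%:C *: Qmx d)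
  end.

Lemma Pmx_mul d (u : 'cV[R[i]]_d) i : (Pmx d *m u) i 0 = d%:R^-1 * \sum_j u j 0.
Proof. by rewrite mxE big_distrr; apply: eq_bigr => j _; rewrite mxE. Qed.

Lemma natC_neq0 d (i : 'I_d) : d%:R != 0 :> R[i].
Proof. by rewrite pnatr_eq0 -lt0n (leq_ltn_trans _ (ltn_ord i)). Qed.

Lemma Pmx_eq0 d (u : 'cV[R[i]]_d) : Pmx d *m u = 0 <-> \sum_j u j 0 = 0.
Proof.
split=> [|su]; last by apply/colP => i; rewrite Pmx_mul su mulr0 mxE.
case: d u => [|d] u; first by rewrite big_ord0.
move=> /colP /(_ ord0) /eqP; rewrite Pmx_mul mxE mulf_eq0 invr_eq0.
by rewrite pnatr_eq0 => /eqP.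
Qed.

Lemma Qmx_mul d (u : 'cV[R[i]]_d) i :
  (Qmx d *m u) i 0 = u i 0 - d%:R^-1 * \sum_j u j 0.
Proof. by rewrite mulmxBl mul1mx -(Pmx_mul u i) [LHS]mxE [X in _ + X]mxE. Qed.

Lemma Qmx_eq0 d (u : 'cV[R[i]]_d) :
  Qmx d *m u = 0 <-> forall j k, u j 0 = u k 0.
Proof.
split=> [/colP Qu j k|uu].
  by have := Qu j; have := Qu k; rewrite !Qmx_mul !mxE => /subr0_eq -> /subr0_eq.
apply/colP => i; rewrite Qmx_mul mxE (eq_bigr (fun=> u i 0)) => [|j _]; last exact: uu.
by rewrite sumr_const card_ord -[u i 0 *+ d]mulr_natl mulKf ?subrr ?natC_neq0.
Qed.

Lemma orth_proj0 n : orth_proj (0 : 'M[R[i]]_n).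
Proof. by split; rewrite ?mul0mx // trmx0 map_mx0. Qed.

Lemma orth_projP d : orth_proj (Pmx d).
Proof.
split; apply/matrixP => i j; rewrite !mxE; last by rewrite fmorphV rmorph_nat.
rewrite (eq_bigr (fun=> d%:R^-1 * d%:R^-1)) => [|k _]; last by rewrite !mxE.
by rewrite sumr_const card_ord -[LHS]mulr_natl mulVKf ?natC_neq0.
Qed.

Lemma PmxQ d : Pmx d *m Qmx d = 0.
Proof. by have [PP _] := orth_projP d; rewrite mulmxBr mulmx1 PP subrr. Qed.

Lemma QmxP d : Qmx d *m Pmx d = 0.
Proof. by have [PP _] := orth_projP d; rewrite mulmxBl mul1mx PP subrr. Qed.

Lemma orth_projQ d : orth_proj (Qmx d).
Proof.
have [_ PA] := orth_projP d; split.
  by rewrite {1}/Qmx mulmxBl mul1mx PmxQ subr0.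
by rewrite /Qmx linearB /= map_mxB trmx1 map_mx1 PA.
Qed.

Lemma vsat_IIa d (F F' : 'cV[R[i]]_d) :
  vsat (vtype_cond TypeIIa d) F F' <->
  (forall j k, F' j 0 = F' k 0) /\ \sum_j F j 0 = 0.
Proof.
split=> [[/Pmx_eq0 ? /Qmx_eq0 ? _] //|[? ?]].
by split; [exact/Pmx_eq0|exact/Qmx_eq0|rewrite /= !mul0mx].
Qed.

Lemma vsat_IIb d beta (b0 : beta != 0) (F F' : 'cV[R[i]]_d) :
  vsat (vtype_cond (TypeIIb b0) d) F F' <->
  (forall j k, F' j 0 = F' k 0) /\
  (forall j, \sum_i F i 0 = beta%:C * F' j 0).
Proof.
have bC0 : beta%:C != 0 :> R[i] by rewrite fmorph_eq0.
have PF : (d%:R / beta)%:C *: Pmx d *m (Pmx d *m F) =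
    \col_j (beta%:C^-1 * \sum_i F i 0).
  have [PP _] := orth_projP d; rewrite -scalemxAl mulmxA PP.
  apply/colP => j; rewrite mxE Pmx_mul mxE rmorphM fmorphV rmorph_nat mulrA.
  by rewrite [_ / beta%:C]mulrC mulfK ?natC_neq0.
have PF' : (forall j k, F' j 0 = F' k 0) -> Pmx d *m F' = F'.
  move=> /Qmx_eq0; rewrite mulmxBl mul1mx => /subr0_eq <- //.
split=> [[_ /Qmx_eq0 FF]|[FF sF]] /=.
  rewrite /= PF PF' // => F'E; split=> // j.
  by rewrite F'E mxE mulVKf.
split; [by rewrite mul0mx|exact/Qmx_eq0|rewrite /= PF PF' //].
by apply/colP => j; rewrite mxE (sF j) mulKf.
Qed.

Lemma vsat_IIIa d C (C0 : C != 0) (F F' : 'cV[R[i]]_d) :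
  vsat (vtype_cond (TypeIIIa C0) d) F F' <->
  \sum_j F j 0 = 0 /\
  (forall j k, F' j 0 - F' k 0 = C%:C * (F j 0 - F k 0)).
Proof.
have QE : Qmx d *m F' = C%:C *: Qmx d *m (Qmx d *m F) <->
    Qmx d *m (F' - C%:C *: F) = 0.
  have [QQ _] := orth_projQ d.
  rewrite -scalemxAl mulmxA QQ mulmxBr -scalemxAr.
  by split=> [->|/subr0_eq//]; rewrite subrr.
have subE : Qmx d *m (F' - C%:C *: F) = 0 <->
    forall j k, F' j 0 - F' k 0 = C%:C * (F j 0 - F k 0).
  apply: (iff_trans (Qmx_eq0 _)); split=> H j k;
    have := H j k; rewrite !mxE mulrBr => /eqP; rewrite -subr_eq0 => /eqP E;
    apply/subr0_eq; rewrite -E; ring.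
split=> [[/Pmx_eq0 ? _ /QE/subE ?] //|[? ?]].
by split; [exact/Pmx_eq0|rewrite /= mul0mx|exact/QE/subE].
Qed.

Lemma vtype_cond_selfadjoint t d : selfadjoint_vcond (vtype_cond t d).
Proof.
have [PP PA] := orth_projP d; have [QQ QA] := orth_projQ d.
have PDQ : Pmx d + Qmx d = 1%:M by rewrite addrC subrK.
have adjZ (a : R) (M : 'M[R[i]]_d) : M ^t* = M -> (a%:C *: M) ^t* = a%:C *: M.
  move=> MA; apply/matrixP => i j; rewrite -{2}MA !mxE rmorphM /=.
  by congr (_ * _); exact: conjc_real.
have inv (a : R) (M : 'M[R[i]]_d) : (M = 0 \/ a != 0) -> M *m M = M ->
    exists N : 'M[R[i]]_d, [/\ M *m N *m M = N, (a%:C *: M) *m N = M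
                             & N *m (a%:C *: M) = M].
  move=> [->|a0] MM.
    by exists 0; rewrite !(scaler0, mul0mx).
  have aC : a%:C != 0 :> R[i] by rewrite fmorph_eq0.
  exists (a%:C^-1 *: M).
  by rewrite -!(scalemxAl, scalemxAr) !MM !scalerA mulfV ?mulVf // scale1r.
case: t => [|b b0|C C0].
- split=> /=; rewrite ?mulmx0 ?mul0mx ?addr0 //; try exact: orth_proj0.
  + exact: PmxQ.
  + by case: (@orth_proj0 d).
  + by exists 0; rewrite !mulmx0.
- split=> /=; rewrite ?mul0mx ?add0r ?subrK ?QmxP //; try exact: orth_proj0.
  + by rewrite -scalemxAr PP -scalemxAl PP.
  + exact: adjZ.
  + apply: inv => //; case: d {PP PA QQ QA PDQ adjZ} => [|d]; [left|right].
      exact: flatmx0.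
    by rewrite mulf_neq0 ?invr_eq0 ?pnatr_eq0.
- split=> /=; rewrite ?mul0mx ?mulmx0 ?addr0 ?PmxQ //; try exact: orth_proj0.
  + by rewrite -scalemxAr QQ -scalemxAl QQ.
  + exact: adjZ.
  + by apply: inv => //; right.
Qed.

End VertexConditions.

Section Laplacian.
Variables (R : realType).
Notation mu := (@lebesgue_measure R).

Definition cint (l : R) (g : R -> R[i]) : R[i] :=
  (\int[mu]_(x in `[0, l]) complex.Re (g x)) +i*
  (\int[mu]_(x in `[0, l]) complex.Im (g x)).

Definition L2 (l : R) (g : R -> R[i]) : Prop :=
  [/\ measurable_fun `[0, l] (fun x => complex.Re (g x)),
      measurable_fun `[0, l] (fun x => complex.Im (g x)) &
      mu.-integrable `[0, l]
        (fun x => (complex.Re (g x) ^+ 2 + complex.Im (g x) ^+ 2)%:E)].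

(* [f] is the continuous representative of an element of H^2(0, l), [f1] that
   of its weak derivative, and [f2] (determined a.e.) its second derivative *)
Record H2 (l : R) (f f1 f2 : R -> R[i]) : Prop := IsH2 {
  H2_f : forall x, x \in `[0, l] -> f x = f 0 + cint x f1;
  H2_f1 : forall x, x \in `[0, l] -> f1 x = f1 0 + cint x f2;
  H2_f2 : L2 l f2
}.

Variable G : metric_graph R.

(* equality in L^2(G) *)
Definition gfun_ae_eq (f g : gfun G) : Prop :=
  forall e, \forall x \ae mu, x \in `[0, len e] -> f e x = g e x.

Variable c : forall v : vert G, vcond R (deg v).

(* [f] is in the domain of the Laplacian H with conditions [c], and H f = g *)
Definition laplacian (f g : gfun G) : Prop :=
  exists f1 f2 : gfun G,
    [/\ forall e, H2 (len e) (f e) (f1 e) (f2 e),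
        forall v, vsat (c v) (bvec f v) (bvec' f1 v) &
        gfun_ae_eq g (fun e x => - f2 e x)].

Definition eigenspace (l : R) (f : gfun G) : Prop :=
  laplacian f (fun e x => l%:C * f e x).

Definition lin_indep n (phi : 'I_n -> gfun G) : Prop :=
  forall a : 'I_n -> R[i],
    gfun_ae_eq (fun e x => \sum_i a i * phi i e x) (fun _ _ => 0) ->
    forall i, a i = 0.

Definition eigenspace_dim_ge (l : R) (n : nat) : Prop :=
  exists phi : 'I_n -> gfun G,
    (forall i, eigenspace l (phi i)) /\ lin_indep phi.

(* [lam] lists the eigenvalues of H in non-decreasing order, each repeated
   dim ker (H - l) times; [lam k] is the (k+1)-st eigenvalue *)
Definition eigenvalue_seq (lam : nat -> R) : Prop :=
  {homo lam : i j / (i <= j)%N >-> i <= j} /\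
  forall (l : R) (n : nat),
    eigenspace_dim_ge l n <->
    exists s : 'I_n -> nat, injective s /\ forall i, lam (s i) = l.

End Laplacian.

Section AddEdge.
Variables (R : realType) (G : metric_graph R) (v1 v2 : vert G).
Variables (l : R) (l_gt0 : 0 < l).

Definition add_edge : metric_graph R :=
  @MetricGraph R (vert G) (option (edge G))
    (fun o => if o is Some e then init e else v1)
    (fun o => if o is Some e then term e else v2)
    (fun o => if o is Some e then len e else l)
    (fun o => match o return 0 < (if o is Some e then len e else l) with
              | Some e => len_gt0 e
              | None => l_gt0
              end).

Definition lift_end (h : edge G + edge G) : edge add_edge + edge add_edge :=
  match h with inl e => inl (Some e) | inr e => inr (Some e) end.

Lemma enum_add_edge (v : vert G) : v != v1 -> v != v2 ->
  enum (ends (G := add_edge) v) = [seq lift_end h | h <- enum (ends (G := G) v)].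
Proof.
move=> nv1 nv2; rewrite !enum_ends map_cat /enum_mem /=.
have -> : Finite.enum (option (edge G)) = None :: map Some (Finite.enum (edge G)).
  by rewrite [in LHS]unlock.
rewrite /= !inE /= eq_sym (negPf nv1) [v2 == v]eq_sym (negPf nv2).
rewrite !filter_map -!map_comp; congr cat; apply: congr1;
  by apply: eq_filter => e /=; rewrite !inE.
Qed.

Lemma deg_add_edge (v : vert G) : v != v1 -> v != v2 ->
  deg (G := G) v = deg (G := add_edge) v.
Proof. by move=> nv1 nv2; rewrite /deg !cardE enum_add_edge ?size_map. Qed.

Lemma enum_val_add_edge v (n1 : v != v1) (n2 : v != v2)
    (j : 'I_(deg (G := add_edge) v)) :
  enum_val j = lift_end (enum_val (cast_ord (esym (deg_add_edge n1 n2)) j)).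
Proof.
set k := cast_ord _ j.
rewrite (enum_val_nth (lift_end (enum_val k))) (enum_val_nth (enum_val k) k).
rewrite enum_add_edge // (nth_map (enum_val k)) //.
by have := ltn_ord k; rewrite {2}/deg cardE.
Qed.

(* the ends at the other vertices are enumerated in the same order, so that
   [cast_vcond (deg_add_edge _ _)] is the same condition on the same ends *)
Lemma bvec_add_edge (f : gfun add_edge) v (n1 : v != v1) (n2 : v != v2) :
  bvec f v = castmx (deg_add_edge n1 n2, erefl 1%N)
    (bvec (fun e : edge G => f (Some e)) v).
Proof.
apply/colP => j; rewrite castmxE !mxE enum_val_add_edge /=.
by case: (enum_val _).
Qed.

Lemma bvec'_add_edge (f : gfun add_edge) v (n1 : v != v1) (n2 : v != v2) :
  bvec' f v = castmx (deg_add_edge n1 n2, erefl 1%N)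
    (bvec' (fun e : edge G => f (Some e)) v).
Proof.
apply/colP => j; rewrite castmxE !mxE enum_val_add_edge /=.
by case: (enum_val _).
Qed.

End AddEdge.

(* Main.v *)
(* Functions on the old graph whose boundary values satisfy the Dirichlet part of
   the vertex conditions extend by zero to the new edge, with the same quadratic
   form and norm, for each of the three types of conditions; the theorem is the
   min-max principle applied to this observation.

   To count eigenvalues below [t] without compactness arguments, divide all
   edges into pieces so short that [t] lies below their Dirichlet spectrum.  For
   [k <= t], a function solving [- u'' = k u] on each piece is determined by its
   values at the nodes, and the form of [H - k] becomes a Hermitian form on the
   finite-dimensional space of nodal values, whose kernel is the eigenspace of
   [H] at [k].  This form is strictly decreasing and Lipschitz continuous in
   [k], and positive for very negative [k].  By monotonicity, eigenvalues of [H]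
   below [t] produce a nonpositive subspace for the form at [t] on the old
   graph; it extends by zero to the new graph, where, by the intermediate value
   theorem for the ordered eigenvalues of the form, it forces at least as many
   eigenvalues of the new operator not exceeding [t]. *)

Require Import Defs.
From mathcomp Require Import all_boot all_order all_algebra.
From mathcomp Require Import all_classical all_reals all_analysis.
From mathcomp Require Import complex.
From mathcomp Require Import spectral ring lra measurable_realfun.

Set Implicit Arguments.
Unset Strict Implicit.
Unset Printing Implicit Defensive.
Import Order.TTheory GRing.Theory Num.Theory.
Import numFieldNormedType.Exports.

(** * The equation u'' = - mu u *)

Section Solutions.
Variable R : realType.
Implicit Types mu nu x t : R.

(** The obstacle is that [eigenvalue_seq] speaks only of multiplicities: neither a variational
    characterization nor completeness of the eigenfunctions is at hand. The two graphs are therefore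
    compared through dimensions of eigenspaces, in one direction each. On the old graph, eigenspaces
    embed into kernels of the nodal form; on the new graph, zeros of its eigenvalues must be
    produced and kernel vectors turned back into eigenfunctions. The form is explicit because a
    piece of an edge has a reflection symmetry: even and odd solutions diagonalize its
    Dirichlet-to-Neumann map, with values [even_dtn] and [odd_dtn]. Only these two numbers depend on
    the spectral parameter; the space of nodal values and the constraints on it do not, so forms for
    different parameters can be compared vector by vector, and zero values on the new edge cost no
    energy for any parameter. *)

Definition wave mu := Num.sqrt `|mu|.

(* The solutions of [u'' = - mu u] with Cauchy data (1, 0) and (0, 1) at 0. *)
Definition cosm mu x : R :=
  if 0 < mu then cos (wave mu * x)
  else if mu < 0 then (expR (wave mu * x) + expR (- (wave mu * x))) / 2
  else 1.

Definition sinm mu x : R :=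
  if 0 < mu then sin (wave mu * x) / wave mu
  else if mu < 0 then (expR (wave mu * x) - expR (- (wave mu * x))) / (2 * wave mu)
  else x.

Lemma cosm0 mu : cosm mu 0 = 1.
Proof.
rewrite /cosm mulr0 oppr0 expR0 cos0.
by case: ifP => // _; case: ifP => // _; field.
Qed.

Lemma sinm0 mu : sinm mu 0 = 0.
Proof.
rewrite /sinm mulr0 oppr0 expR0 sin0 subrr !mul0r.
by case: ifP => // _; case: ifP.
Qed.

Lemma wave_sq mu : wave mu ^+ 2 = `|mu|.
Proof. by rewrite sqr_sqrtr. Qed.

Lemma wave_neq0 mu : mu != 0 -> wave mu != 0.
Proof. by rewrite sqrtr_eq0 normr_le0. Qed.

Lemma is_derive_cosm mu x : is_derive x 1 (cosm mu) (- mu * sinm mu x).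
Proof.
have [mu0|mu0|mu0] := ltrgtP 0 mu.
- have -> : cosm mu = fun x => cos (wave mu * x).
    by apply/funext => y; rewrite /cosm mu0.
  rewrite /sinm mu0.
  apply: is_derive_eq.
  rewrite [- mu](_ : _ = - wave mu ^+ 2); last by rewrite wave_sq gtr0_norm.
  by have w0 := wave_neq0 (lt0r_neq0 mu0); rewrite /GRing.scale/=; field.
- have -> : cosm mu = fun x => (expR (wave mu * x) + expR (- (wave mu * x))) / 2.
    by apply/funext => y; rewrite /cosm mu0 ltNge (ltW mu0).
  rewrite /sinm mu0 ltNge (ltW mu0) /=.
  apply: is_derive_eq.
  rewrite [- mu](_ : _ = wave mu ^+ 2); last by rewrite wave_sq ltr0_norm.
  by have w0 := wave_neq0 (ltr0_neq0 mu0); rewrite /GRing.scale/=; field.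
- have -> : cosm mu = fun=> 1.
    by apply/funext => y; rewrite /cosm -mu0 ltxx.
  by rewrite -mu0 oppr0 mul0r; apply: is_derive_cst.
Qed.

Lemma is_derive_sinm mu x : is_derive x 1 (sinm mu) (cosm mu x).
Proof.
have [mu0|mu0|mu0] := ltrgtP 0 mu.
- have -> : sinm mu = fun x => sin (wave mu * x) / wave mu.
    by apply/funext => y; rewrite /sinm mu0.
  rewrite /cosm mu0.
  apply: is_derive_eq.
  by have w0 := wave_neq0 (lt0r_neq0 mu0); rewrite /GRing.scale/=; field.
- have -> : sinm mu =
      fun x => (expR (wave mu * x) - expR (- (wave mu * x))) / (2 * wave mu).
    by apply/funext => y; rewrite /sinm mu0 ltNge (ltW mu0).
  rewrite /cosm mu0 ltNge (ltW mu0) /=.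
  apply: is_derive_eq.
  by have w0 := wave_neq0 (ltr0_neq0 mu0); rewrite /GRing.scale/=; field.
- have -> : sinm mu = id.
    by apply/funext => y; rewrite /sinm -mu0 ltxx.
  by rewrite -mu0 /cosm ltxx; apply: is_derive_id.
Qed.


Lemma cosm_sinm_id mu x : cosm mu x ^+ 2 + mu * sinm mu x ^+ 2 = 1.
Proof.
have -> : 1 = (fun x => cosm mu x ^+ 2 + mu * sinm mu x ^+ 2) 0.
  by rewrite /= cosm0 sinm0; ring.
apply: (is_derive_0_is_cst (f := fun x => cosm mu x ^+ 2 + mu * sinm mu x ^+ 2)).
move=> y.
have dc := is_derive_cosm mu y; have ds := is_derive_sinm mu y.
by apply: is_derive_eq; rewrite /GRing.scale /=; ring.
Qed.

Lemma cosm_continuous mu : continuous (cosm mu).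
Proof.
move=> x; apply/differentiable_continuous/derivable1_diffP.
by have [] := is_derive_cosm mu x.
Qed.

Lemma sinm_continuous mu : continuous (sinm mu).
Proof.
move=> x; apply/differentiable_continuous/derivable1_diffP.
by have [] := is_derive_sinm mu x.
Qed.

Lemma is_derive0_itv (g : R -> R) x : 0 <= x ->
  (forall t, t \in `]0, x[ -> is_derive t 1 g 0) ->
  {within `[0, x], continuous g} -> g x = g 0.
Proof.
move=> x0 dg cg; have [_ _] := MVT_segment x0 dg cg.
by rewrite mul0r => /subr0_eq.
Qed.

(** Two first integrals: [u] and [u1] combined through the inverse of the fundamental matrix are
    constant, and [cosm_sinm_id] says that this matrix has determinant 1. Derivatives inside and
    continuity up to the ends are what primitives of continuous functions provide. *)
Lemma wave_unique mu (u u1 : R -> R) l :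
  {within `[0, l], continuous u} -> {within `[0, l], continuous u1} ->
  (forall t, t \in `]0, l[ -> is_derive t 1 u (u1 t)) ->
  (forall t, t \in `]0, l[ -> is_derive t 1 u1 (- mu * u t)) ->
  forall x, x \in `[0, l] ->
  u x = u 0 * cosm mu x + u1 0 * sinm mu x /\
  u1 x = - mu * u 0 * sinm mu x + u1 0 * cosm mu x.
Proof.
move=> cu cu1 du du1 x /[!in_itv]/= /andP[x0 xl].
have sub : `[0, x] `<=` `[0, l].
  by move=> y /=; rewrite !in_itv/= => /andP[-> /le_trans->].
have {}cu := continuous_subspaceW sub cu.
have {}cu1 := continuous_subspaceW sub cu1.
have cc := continuous_subspaceT (A := `[0, x]) (@cosm_continuous mu).
have cs := continuous_subspaceT (A := `[0, x]) (@sinm_continuous mu).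
have in_l t : t \in `]0, x[ -> t \in `]0, l[.
  by rewrite !in_itv/= => /andP[-> /lt_le_trans->].
have E1 : u x * cosm mu x - u1 x * sinm mu x = u 0.
  have := @is_derive0_itv (fun t => u t * cosm mu t - u1 t * sinm mu t) x x0.
  rewrite cosm0 sinm0 mulr1 mulr0 subr0; apply.
    move=> t /in_l tl; have du' := du t tl; have du1' := du1 t tl.
    have dc := is_derive_cosm mu t; have ds := is_derive_sinm mu t.
    by apply: is_derive_eq; rewrite /GRing.scale /=; ring.
  by move=> t; apply: cvgB; apply: cvgM; [exact: cu|exact: cc|exact: cu1|exact: cs].
have E2 : mu * u x * sinm mu x + u1 x * cosm mu x = u1 0.
  have := @is_derive0_itv (fun t => mu * u t * sinm mu t + u1 t * cosm mu t) x x0.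
  rewrite cosm0 sinm0 mulr1 mulr0 add0r; apply.
    move=> t /in_l tl; have du' := du t tl; have du1' := du1 t tl.
    have dc := is_derive_cosm mu t; have ds := is_derive_sinm mu t.
    by apply: is_derive_eq; rewrite /GRing.scale /=; ring.
  move=> t; apply: cvgD; apply: cvgM; [|exact: cs|exact: cu1|exact: cc].
  by apply: cvgM; [exact: cvg_cst|exact: cu].
have pyth := cosm_sinm_id mu x.
by split; rewrite -E1 -E2 -[LHS]mulr1 -pyth; ring.
Qed.

Lemma is_derive_shift (f : R -> R) x t d :
  is_derive (x + t) 1 f d -> is_derive t 1 (fun t => f (x + t)) d.
Proof.
move=> df; have dg : is_derive t 1 (fun t => x + t) 1.
  have := is_deriveD (is_derive_cst x t 1) (is_derive_id t (1 : R)).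
  by rewrite add0r.
have := is_derive1_comp (f := f) (g := fun t => x + t) df dg.
by rewrite mulr1.
Qed.

(** Translates solve the same equation, so [wave_unique] on [[0, y]] expands them by their Cauchy
    data at [x]. *)
Lemma wave_add mu x y : 0 <= y ->
  cosm mu (x + y) = cosm mu x * cosm mu y - mu * sinm mu x * sinm mu y /\
  sinm mu (x + y) = sinm mu x * cosm mu y + cosm mu x * sinm mu y.
Proof.
move=> y0; have yy : y \in `[0, y] by rewrite in_itv/= y0 lexx.
have shc (f : R -> R) : continuous f -> {within `[0, y], continuous (fun t => f (x + t))}.
  move=> cf; apply: continuous_subspaceT => t.
  apply: (@continuous_comp _ _ _ (fun t => x + t) f); last exact: cf.
  by apply: continuousD; [exact: cst_continuous|].
have cc := shc _ (@cosm_continuous mu); have cs := shc _ (@sinm_continuous mu).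
have cs' : {within `[0, y], continuous (fun t => - mu * sinm mu (x + t))}.
  by move=> t; apply: cvgM; [exact: cvg_cst|exact: cs].
have dc t : is_derive t 1 (fun t => cosm mu (x + t)) (- mu * sinm mu (x + t)).
  by apply: is_derive_shift; exact: is_derive_cosm.
have ds t : is_derive t 1 (fun t => sinm mu (x + t)) (cosm mu (x + t)).
  by apply: is_derive_shift; exact: is_derive_sinm.
have ds' t : is_derive t 1 (fun t => - mu * sinm mu (x + t)) (- mu * cosm mu (x + t)).
  by have := ds t => ?; apply: is_derive_eq; rewrite /GRing.scale/=; ring.
have := wave_unique cc cs' (fun t _ => dc t) (fun t _ => ds' t) yy.
have := wave_unique cs cc (fun t _ => ds t) (fun t _ => dc t) yy.
by rewrite !addr0 => -[-> _] [-> _]; split; ring.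
Qed.

Lemma cosm_le1 mu x : 0 <= mu -> `|cosm mu x| <= 1.
Proof.
move=> mu0; rewrite -(@ler_pXn2r _ 2) ?nnegrE ?normr_ge0 ?ler01 // expr1n.
rewrite real_normK ?num_real // -[leRHS](cosm_sinm_id mu x) lerDl.
by rewrite mulr_ge0 ?sqr_ge0.
Qed.

Lemma MVT0 (f df : R -> R) t : 0 < t ->
  (forall x, is_derive x 1 f (df x)) ->
  exists2 x, (0 < x) && (x < t) & f t = f 0 + df x * t.
Proof.
move=> t0 dfE.
have cf : {within `[0, t], continuous f}.
  by apply: derivable_within_continuous => x _; have [] := dfE x.
have [x] := MVT t0 (fun x _ => dfE x) cf.
by rewrite in_itv /= subr0 => xt E; exists x => //; rewrite -E addrC subrK.
Qed.

(** A piece has length [2 * tau], and its Dirichlet spectrum starts at [(pi / (2 * tau)) ^ 2]. The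
    bound [1 / (2 * tau ^ 2)] lies safely below and yields [1 / 2 <= cosm] without reference to
    pi. *)
Definition short mu (tau : R) := 0 < tau /\ mu * tau ^+ 2 *+ 2 <= 1.

Lemma short_le mu nu tau : mu <= nu -> short nu tau -> short mu tau.
Proof.
move=> mn [t0 H]; split=> //; apply: le_trans H.
by rewrite lerMn2r /= ler_wpM2r ?sqr_ge0.
Qed.

Lemma cosm_ge1 mu x : mu <= 0 -> 1 <= cosm mu x.
Proof.
move=> mu0; have c0 : 0 < cosm mu x.
  rewrite /cosm [0 < mu]ltNge mu0 /=; case: ifP => // _.
  by rewrite divr_gt0 // addr_gt0 ?expR_gt0.
rewrite -(@ler_pXn2r _ 2) ?nnegrE ?(ltW c0) ?ler01 // expr1n.
by rewrite -[leLHS](cosm_sinm_id mu x) gerDl mulr_le0_ge0 ?sqr_ge0.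
Qed.

(** For [mu > 0], two mean values give [cosm mu x = 1 - mu * cosm mu z * y * x] with
    [cosm mu z <= 1], while [mu * tau ^ 2 <= 1 / 2]. *)
Lemma cosm_ge_half mu tau x : short mu tau -> 0 <= x <= tau -> 1 / 2 <= cosm mu x.
Proof.
move=> [t0 st] /andP[x0 xt].
have [mu0|mu0] := ltP 0 mu; last by have := cosm_ge1 x mu0; lra.
move: x0; rewrite le_eqVlt => /predU1P[<-|x0].
  by rewrite cosm0; lra.
have [y /andP[y0 yx] ->] := MVT0 x0 (is_derive_cosm mu).
have [z /andP[z0 zy] ->] := MVT0 y0 (is_derive_sinm mu).
rewrite cosm0 sinm0 add0r.
have cz : cosm mu z <= 1 by rewrite (le_trans (ler_norm _)) ?cosm_le1 ?ltW.
have yxt : y * x <= tau ^+ 2.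
  by rewrite expr2 ler_pM ?(ltW x0) ?(ltW y0) // (le_trans (ltW yx)).
have : mu * (cosm mu z * (y * x)) <= mu * tau ^+ 2.
  rewrite ler_pM2l // (le_trans _ yxt) // ler_piMl //.
  by rewrite mulr_ge0 ?ltW.
by move: st; rewrite mulr2n; lra.
Qed.

Lemma sinm_gt0 mu tau x : short mu tau -> 0 < x <= tau -> 0 < sinm mu x.
Proof.
move=> smt /andP[x0 xt].
have [y /andP[y0 yx] ->] := MVT0 x0 (is_derive_sinm mu).
rewrite sinm0 add0r mulr_gt0 //.
have := @cosm_ge_half mu tau y smt; rewrite (ltW y0) (le_trans (ltW yx) xt).
by move=> /(_ isT); lra.
Qed.

Lemma cosm_gt0 mu tau : short mu tau -> 0 < cosm mu tau.
Proof.
move=> smt; have := @cosm_ge_half mu tau tau smt; rewrite lexx ltW ?smt.1 //.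
by move=> /(_ isT); lra.
Qed.

Lemma sinm_tau_gt0 mu tau : short mu tau -> 0 < sinm mu tau.
Proof. by move=> smt; apply: (sinm_gt0 smt); rewrite lexx smt.1. Qed.

Lemma MVT_itv (f df : R -> R) a b : a <= b ->
  (forall x, is_derive x 1 f (df x)) ->
  exists2 x, x \in `[a, b] & f b = f a + df x * (b - a).
Proof.
move=> ab dfE.
have cf : {within `[a, b], continuous f}.
  by apply: derivable_within_continuous => x _; have [] := dfE x.
have [x xt E] := MVT_segment ab (fun x _ => dfE x) cf.
by exists x => //; rewrite -E addrC subrK.
Qed.

Lemma sinm_le mu tau x : short mu tau -> 0 <= x <= tau -> sinm mu x <= sinm mu tau.
Proof.
move=> smt /andP[x0 xt].
have [y] := MVT_itv xt (is_derive_sinm mu); rewrite in_itv /= => /andP[xy yt] ->.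
rewrite lerDl mulr_ge0 ?subr_ge0 //.
have := @cosm_ge_half mu tau y smt; rewrite (le_trans x0 xy) yt.
by move=> /(_ isT); lra.
Qed.

Lemma cosm_le mu tau x : short mu tau -> 0 <= x <= tau -> cosm mu x <= 2 * cosm mu tau.
Proof.
move=> smt /andP[x0 xt].
have [mu0|mu0] := ltP 0 mu.
  apply: (@le_trans _ _ 1).
    by rewrite (le_trans (ler_norm _)) ?cosm_le1 ?ltW.
  have := @cosm_ge_half mu tau tau smt; rewrite lexx (le_trans x0 xt).
  by move=> /(_ isT); lra.
have [y] := MVT_itv xt (is_derive_cosm mu); rewrite in_itv /= => /andP[xy yt] E.
apply: (@le_trans _ _ (cosm mu tau)); last first.
  by have := cosm_ge1 tau mu0; lra.
rewrite E lerDl mulr_ge0 ?subr_ge0 // mulr_ge0 ?oppr_ge0 //.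
have := le_trans x0 xy; rewrite le_eqVlt => /predU1P[<-|y0]; first by rewrite sinm0.
by rewrite ltW // (sinm_gt0 smt) // y0.
Qed.

(* With [u] the solution of [u'' = - mu u] on [[-tau, tau]] that is even
   (resp. odd), these are [u'(tau) / u(tau)]. *)
Definition even_dtn mu tau := - mu * sinm mu tau / cosm mu tau.
Definition odd_dtn mu tau := cosm mu tau / sinm mu tau.

(* The Wronskian of the even solutions for [mu] and [nu] has derivative
   [(nu - mu) * cosm mu * cosm nu]; similarly for the odd ones below. *)
Lemma even_dtn_lt mu nu tau : mu < nu -> short nu tau ->
  0 < even_dtn mu tau - even_dtn nu tau <= 4 * tau * (nu - mu).
Proof.
move=> mn sn; have sm := short_le (ltW mn) sn; have t0 := sn.1.
have cm0 := cosm_gt0 sm; have cn0 := cosm_gt0 sn.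
have dW x : is_derive x 1
    (fun x => nu * cosm mu x * sinm nu x - mu * sinm mu x * cosm nu x)
    ((nu - mu) * (cosm mu x * cosm nu x)).
  have ? := is_derive_cosm mu x; have ? := is_derive_cosm nu x.
  have ? := is_derive_sinm mu x; have ? := is_derive_sinm nu x.
  by apply: is_derive_eq; rewrite /GRing.scale/=; ring.
have [y /andP[y0 yt]] := MVT0 t0 dW; rewrite !sinm0 !mulr0 mul0r subrr add0r => W.
have E : even_dtn mu tau - even_dtn nu tau =
    (nu - mu) * (cosm mu y / cosm mu tau) * (cosm nu y / cosm nu tau) * tau.
  rewrite (_ : _ - _ = (nu * cosm mu tau * sinm nu tau - mu * sinm mu tau * cosm nu tau)
     / (cosm mu tau * cosm nu tau)).
    by rewrite W; field; rewrite !gt_eqF.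
  by rewrite /even_dtn; field; rewrite !gt_eqF.
(* Each of the two ratios is at most 2, whence the factor 4. *)
have ratio k : short k tau -> 0 < cosm k y / cosm k tau <= 2.
  move=> sk; have ck := cosm_gt0 sk.
  rewrite divr_gt0 // ?ler_pdivrMr //; last first.
    have := @cosm_ge_half k tau y sk; rewrite (ltW y0) (ltW yt).
    by move=> /(_ isT); lra.
  by rewrite (cosm_le sk) // (ltW y0) ltW.
have /andP[] := ratio _ sm; have /andP[] := ratio _ sn; rewrite E.
move: (cosm mu y / _) (cosm nu y / _) => p q q0 qle p0 ple.
rewrite !mulr_gt0 ?subr_gt0 //= [leRHS](_ : _ = (nu - mu) * 2 * 2 * tau); last by ring.
by rewrite ler_pM2r // -!mulrA ler_pM2l ?subr_gt0 // ler_pM ?(ltW p0) ?(ltW q0) //; lra.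
Qed.

Lemma odd_dtn_lt mu nu tau : mu < nu -> short nu tau ->
  0 < odd_dtn mu tau - odd_dtn nu tau <= 4 * tau * (nu - mu).
Proof.
move=> mn sn; have sm := short_le (ltW mn) sn; have t0 := sn.1.
have cm0 := sinm_tau_gt0 sm; have cn0 := sinm_tau_gt0 sn.
have dW x : is_derive x 1
    (fun x => cosm mu x * sinm nu x - sinm mu x * cosm nu x)
    ((nu - mu) * (sinm mu x * sinm nu x)).
  have ? := is_derive_cosm mu x; have ? := is_derive_cosm nu x.
  have ? := is_derive_sinm mu x; have ? := is_derive_sinm nu x.
  by apply: is_derive_eq; rewrite /GRing.scale/=; ring.
have [y /andP[y0 yt]] := MVT0 t0 dW; rewrite !sinm0 !mulr0 mul0r subrr add0r => W.
have E : odd_dtn mu tau - odd_dtn nu tau =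
    (nu - mu) * (sinm mu y / sinm mu tau) * (sinm nu y / sinm nu tau) * tau.
  rewrite (_ : _ - _ = (cosm mu tau * sinm nu tau - sinm mu tau * cosm nu tau)
     / (sinm mu tau * sinm nu tau)).
    by rewrite W; field; rewrite !gt_eqF.
  by rewrite /odd_dtn; field; rewrite !gt_eqF.
(* By monotonicity the ratios are at most 1 here; the factor 4 is kept to match the even case. *)
have ratio k : short k tau -> 0 < sinm k y / sinm k tau <= 1.
  move=> sk; have ck := sinm_tau_gt0 sk.
  rewrite divr_gt0 // ?ler_pdivrMr ?mul1r //; last first.
    by rewrite (sinm_gt0 sk) // y0 ltW.
  by rewrite (sinm_le sk) // (ltW y0) ltW.
have /andP[] := ratio _ sm; have /andP[] := ratio _ sn; rewrite E.
move: (sinm mu y / _) (sinm nu y / _) => p q q0 qle p0 ple.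
rewrite !mulr_gt0 ?subr_gt0 //= [leRHS](_ : _ = (nu - mu) * 2 * 2 * tau); last by ring.
by rewrite ler_pM2r // -!mulrA ler_pM2l ?subr_gt0 // ler_pM ?(ltW p0) ?(ltW q0) //; lra.
Qed.

(** For very negative [mu] both quotients grow like the square root of [- mu]. The term [tau ^- 2]
    ensures [1 <= - mu * s ^+ 2], so that [c ^+ 2 = 1 - mu * s ^+ 2] is at most twice
    [- mu * s ^+ 2]; the 2 in [2 * M ^+ 2] pays for this. *)
Lemma dtn_ge M mu tau : 0 < M -> 0 < tau ->
  mu <= - (2 * M ^+ 2 + tau ^- 2) ->
  M <= even_dtn mu tau /\ M <= odd_dtn mu tau.
Proof.
move=> M0 t0 muM.
have t2 : 0 <= tau ^- 2 by rewrite -exprVn sqr_ge0.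
have muN : mu <= 0 by have := sqr_ge0 M; lra.
have st : short mu tau.
  by split=> //; have := mulr_le0_ge0 muN (sqr_ge0 tau); rewrite mulr2n; lra.
have c0 := cosm_gt0 st; have s0 := sinm_tau_gt0 st.
have tm : 1 <= - mu * tau ^+ 2.
  rewrite -ler_pdivrMr ?exprn_gt0 // div1r.
  by move: muM; have := sqr_ge0 M; lra.
have M2 : 2 * M ^+ 2 <= - mu by lra.
have sge : tau <= sinm mu tau.
  have [y /andP[y0 yt] ->] := MVT0 t0 (is_derive_sinm mu).
  by rewrite sinm0 add0r ler_peMl ?(ltW t0) // cosm_ge1.
have := cosm_sinm_id mu tau; rewrite /even_dtn /odd_dtn.
set c := cosm mu tau in c0 *; set s := sinm mu tau in s0 sge * => id1.
have c2E : c ^+ 2 = 1 + (- mu) * s ^+ 2 by rewrite -id1; ring.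
have ms2 : 1 <= - mu * s ^+ 2.
  apply: (le_trans tm); rewrite ler_wpM2l ?oppr_ge0 //.
  by rewrite ler_pXn2r ?nnegrE ?(ltW t0) ?(ltW s0).
have Ms : (M * s) ^+ 2 *+ 2 <= - mu * s ^+ 2.
  by rewrite exprMn -mulrnAl -mulr_natl ler_pM2r ?exprn_gt0.
rewrite !ler_pdivlMr //; split.
  rewrite -(@ler_pXn2r _ 2) ?nnegrE ?mulr_ge0 ?oppr_ge0 ?(ltW c0) ?(ltW s0) ?(ltW M0) //.
  rewrite !exprMn c2E.
  have : M ^+ 2 * (1 - mu * s ^+ 2) <= M ^+ 2 * (2 * (- mu * s ^+ 2)).
    by rewrite ler_pM2l ?exprn_gt0 //; lra.
  have : (2 * M ^+ 2) * (- mu * s ^+ 2) <= - mu * (- mu * s ^+ 2).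
    by rewrite ler_pM2r // (lt_le_trans ltr01).
  by lra.
rewrite -(@ler_pXn2r _ 2) ?nnegrE ?mulr_ge0 ?(ltW c0) ?(ltW s0) ?(ltW M0) //.
by rewrite c2E; move: Ms; rewrite mulr2n; have := sqr_ge0 (M * s); lra.
Qed.

End Solutions.

(** * Families of Hermitian matrices *)

Section HermitianForms.
Variable R : realType.
Local Notation C := R[i].

Definition csq (z : C) : R := complex.Re z ^+ 2 + complex.Im z ^+ 2.

Lemma csq_ge0 z : 0 <= csq z.
Proof. by rewrite addr_ge0 ?sqr_ge0. Qed.

Lemma csqE z : (csq z)%:C = z * z^*%R.
Proof. by rewrite /csq add_Re2_Im2 normCK. Qed.

Lemma csq_eq0 z : (csq z == 0) = (z == 0).
Proof.
case: z => a b; rewrite /csq /= paddr_eq0 ?sqr_ge0 // !sqrf_eq0.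
by rewrite eq_complex.
Qed.

(** Row vectors, so that subspaces are row spaces and [mxrank] counts dimensions. For Hermitian [A]
    the value is already real; the real part places it in [R]. *)
Definition hform n (A : 'M[C]_n) (x : 'rV[C]_n) : R :=
  complex.Re ((x *m A *m x^t* ) 0 0).

Definition sqnorm n (x : 'rV[C]_n) : R := \sum_i csq (x 0 i).

Lemma ReD (x y : C) : complex.Re (x + y) = complex.Re x + complex.Re y.
Proof. by case: x; case: y. Qed.

Lemma ImD (x y : C) : complex.Im (x + y) = complex.Im x + complex.Im y.
Proof. by case: x; case: y. Qed.

Lemma Re_sum I (r : seq I) (P : pred I) (F : I -> C) :
  complex.Re (\sum_(i <- r | P i) F i) = \sum_(i <- r | P i) complex.Re (F i).
Proof. by apply: (big_morph _ ReD). Qed.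

Lemma sqnormE n (x : 'rV[C]_n) : (sqnorm x)%:C = (x *m x^t* ) 0 0.
Proof.
rewrite mxE /sqnorm rmorph_sum /=; apply: eq_bigr => i _.
by rewrite csqE !mxE.
Qed.

Lemma sqnorm_ge0 n (x : 'rV[C]_n) : 0 <= sqnorm x.
Proof. by apply: sumr_ge0 => i _; apply: csq_ge0. Qed.

Lemma sqnorm_gt0 n (x : 'rV[C]_n) : x != 0 -> 0 < sqnorm x.
Proof.
move=> x0; rewrite lt_neqAle sqnorm_ge0 andbT eq_sym.
apply: contra x0; rewrite psumr_eq0 => [|i _]; last exact: csq_ge0.
move=> /allP x0; apply/eqP/rowP => i; rewrite mxE; apply/eqP.
by rewrite -csq_eq0; apply: (implyP (x0 i (mem_index_enum i))).
Qed.

Lemma sqnorm_unitary m n (x : 'rV[C]_m) (B : 'M[C]_(m, n)) :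
  B \is unitarymx -> sqnorm (x *m B) = sqnorm x.
Proof.
move=> Bu; apply/eqP; rewrite -(inj_eq (@complexI R)) !sqnormE.
by rewrite trmx_mul map_mxM mulmxA mulmxtVK.
Qed.

Lemma spectral_decomp n (A : 'M[C]_n) : A^t* = A ->
  exists2 P : 'M[C]_n, P \is unitarymx &
    P *m A = diag_mx (\row_i (complex.Re (spectral_diag A 0 i))%:C) *m P.
Proof.
move=> Ah; have Ahs : A \is hermsymmx.
  by apply/is_hermitianmxP; rewrite expr0 scale1r Ah.
have Pu := spectral_unitarymx A.
exists (spectralmx A) => //.
have /orthomx_spectralP E := hermitian_normalmx Ahs; rewrite [X in _ *m X = _]E.
rewrite !mulmxA mulmxV ?spectral_unit // mul1mx; congr (diag_mx _ *m _).
apply/rowP => i; rewrite mxE RRe_real //.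
by have /mxOverP := hermitian_spectral_diag_real Ahs; apply.
Qed.

Lemma hform_diag n (A P : 'M[C]_n) (d : 'I_n -> R) (z : 'rV[C]_n) :
  P \is unitarymx -> P *m A = diag_mx (\row_i (d i)%:C) *m P ->
  hform A (z *m P) = \sum_i d i * csq (z 0 i).
Proof.
move=> Pu PA; rewrite /hform -(mulmxA z) PA trmx_mul map_mxM !mulmxA.
rewrite (mulmxtVK _ Pu) mxE Re_sum; apply: eq_bigr => i _.
rewrite mul_mx_diag !mxE [z 0 i * _]mulrC -mulrA -csqE.
by rewrite -rmorphM.
Qed.

(** To be used with [P] the matrix of eigenvectors and [S] the eigenvalues below, above or equal to
    a level. *)
Lemma coordinate_space n (P : 'M[C]_n) (S : {set 'I_n}) : P \is unitarymx ->
  exists W : 'M[C]_(#|S|, n),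
  [/\ \rank W = #|S|, forall i, exists2 j, j \in S & row i W = row j P &
      forall x : 'rV[C]_n, (x <= W)%MS -> forall i, i \notin S -> (x *m P^t* ) 0 i = 0].
Proof.
move=> Pu; pose W : 'M[C]_(#|S|, n) := rowsub enum_val P.
exists W; split.
- apply: mxrank_unitary; apply/unitarymxP/matrixP => i j.
  have /matrixP/(_ (enum_val i) (enum_val j)) := unitarymxP Pu.
  rewrite !mxE (inj_eq enum_val_inj) => <-.
  by apply: eq_bigr => k _; rewrite !mxE.
- move=> i; exists (enum_val i); first exact: enum_valP.
  by apply/rowP => j; rewrite !mxE.
move=> x /submxP[y ->] i iS.
rewrite -mulmxA mul_rowsub_mx (unitarymxP Pu) mxE big1 // => k _.
rewrite !mxE; case: eqP => [E|]; last by rewrite mulr0.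
by move: iS; rewrite -E enum_valP.
Qed.

Definition evals n (A : 'M[C]_n) : seq R :=
  [seq complex.Re (spectral_diag A 0 i) | i <- enum 'I_n].

(** Numbered from 0; the default value is returned for [j >= n], hence the bounds [j < n] below. *)
Definition ev n (A : 'M[C]_n) (j : nat) : R := nth 0 (sort <=%O (evals A)) j.

Lemma count_evals n (A : 'M[C]_n) (p : pred R) :
  count p (evals A) = #|[set i | p (complex.Re (spectral_diag A 0 i))]%SET|.
Proof.
rewrite count_map -sum1_count big_enum_cond -sum1_card.
by apply: eq_bigl => i; rewrite !inE.
Qed.

Lemma submx_cap_neq0 m1 m2 n (V : 'M[C]_(m1, n)) (W : 'M[C]_(m2, n)) :
  (n < \rank V + \rank W)%N -> exists2 x : 'rV[C]_n, x != 0 & (x <= V)%MS && (x <= W)%MS.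
Proof.
move=> lt; have : (V :&: W)%MS != 0.
  rewrite -mxrank_eq0; apply: contraTneq lt => cap0.
  by rewrite -mxrank_sum_cap cap0 addn0 -leqNgt rank_leq_col.
by move=> /rowV0Pn[x]; rewrite sub_capmx => xVW x0; exists x.
Qed.

(* Courant-Fischer *)
Lemma ev_le n (A : 'M[C]_n) j t : A^t* = A -> (j < n)%N ->
  ev A j <= t <->
  exists2 W : 'M[C]_n, (j < \rank W)%N &
    forall x : 'rV[C]_n, (x <= W)%MS -> hform A x <= t * sqnorm x.
Proof.
move=> Ah jn; have [P Pu PA] := spectral_decomp Ah.
have srt : sorted <=%O (sort <=%O (evals A)) by apply: sort_le_sorted.
have sz : size (sort <=%O (evals A)) = n by rewrite size_sort size_map size_enum_ord.
have coord (x : 'rV[C]_n) : x = x *m P^t* *m P by rewrite mulmxKtV.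
pose S := [set i : 'I_n | complex.Re (spectral_diag A 0 i) <= t]%SET.
have ct : count (<= t) (sort <=%O (evals A)) = #|S|.
  by rewrite (permP (permEl (perm_sort _ _))) count_evals.
split=> [ejt|[W jW Wle]].
  have [W [rW _ WP]] := coordinate_space S Pu.
  exists <<W>>%MS.
    rewrite mxrank_gen rW -ct ltnNge; apply/negP => ctj.
    have := @nth_count_gt _ _ t 0 _ j srt; rewrite ctj sz jn => /(_ isT).
    by rewrite ltNge ejt.
  move=> x; rewrite genmxE => xW; rewrite (coord x) sqnorm_unitary // (hform_diag _ Pu PA).
  rewrite /sqnorm mulr_sumr; apply: ler_sum => i _.
  have [it|it] := boolP (i \in S).
    by rewrite ler_wpM2r ?csq_ge0 //; rewrite inE in it.
  by rewrite (WP _ xW i it) /csq /= !expr0n /= addr0 !mulr0.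
rewrite leNgt; apply/negP => tej.
have [V [rV _ VP]] := coordinate_space (~: S) Pu.
(* At most [j] eigenvalues are [<= t], so the span [V] of the other eigenvectors meets [W] in a
   nonzero [x], where the form exceeds [t * sqnorm x]. *)
have [|x x0 /andP[xV xW]] := @submx_cap_neq0 _ _ _ V W.
  rewrite -[ltnLHS]card_ord -(cardsC S) rV addnC ltn_add2l -ct.
  apply: leq_ltn_trans jW; rewrite leqNgt; apply/negP => jct.
  by have := nth_count_le 0 srt jct; rewrite leNgt tej.
have := Wle x xW; apply/negP; rewrite -ltNge.
rewrite (coord x) sqnorm_unitary // (hform_diag _ Pu PA).
have z0 : x *m P^t* != 0.
  by apply: contra x0 => /eqP z0; rewrite (coord x) z0 mul0mx.
rewrite -subr_gt0 /sqnorm mulr_sumr -sumrB.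
have terms i : 0 <= complex.Re (spectral_diag A 0 i) * csq ((x *m P^t* ) 0 i) -
    t * csq ((x *m P^t* ) 0 i).
  rewrite -mulrBl.
  have [it|it] := boolP (i \in ~: S).
    by rewrite mulr_ge0 ?csq_ge0 // subr_ge0 ltW // ltNge; rewrite !inE in it.
  by rewrite (VP _ xV i it) /csq /= !expr0n /= addr0 !mulr0.
rewrite lt_neqAle sumr_ge0 // andbT eq_sym; apply: contra z0.
rewrite psumr_eq0 // => /allP z0; apply/eqP/rowP => i; rewrite [RHS]mxE.
have := z0 i (mem_index_enum i); rewrite -mulrBl mulf_eq0 subr_eq0 csq_eq0.
have [it|it] := boolP (i \in ~: S); last by rewrite (VP _ xV i it).
by rewrite !inE -ltNge in it; rewrite gt_eqF //= => /eqP.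
Qed.

(** A subspace optimal for [B] in [ev_le] serves as a test space for [A]. *)
Lemma ev_lipschitz n (A B : 'M[C]_n) j d : A^t* = A -> B^t* = B -> (j < n)%N ->
  (forall x, hform A x <= hform B x + d * sqnorm x) -> ev A j <= ev B j + d.
Proof.
move=> Ah Bh jn AB; apply/(ev_le _ Ah jn).
have /(ev_le _ Bh jn)[W rW Wle] := lexx (ev B j).
exists W => // x xW; apply: le_trans (AB x) _.
by rewrite mulrDl lerD2r Wle.
Qed.

Lemma ev_eq0_card n (A : 'M[C]_n) : A^t* = A ->
  (#|[set j : 'I_n | ev A j == 0%R]%SET| <= \rank (kermx A))%N.
Proof.
move=> Ah; have [P Pu PA] := spectral_decomp Ah.
have [W [rW WP _]] :=
  coordinate_space [set i | complex.Re (spectral_diag A 0 i) == 0]%SET Pu.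
rewrite (_ : #|_| = \rank W).
  apply: mxrankS; apply/row_subP => i; rewrite sub_kermx.
  have [j] := WP i; rewrite inE => /eqP dj ->.
  rewrite -row_mul PA; apply/eqP/rowP => k; rewrite mul_diag_mx !mxE.
  by rewrite dj mul0r.
rewrite rW -(count_evals A (pred1 0)) -(permP (permEl (perm_sort <=%O _))).
rewrite -sum1_count (big_nth 0) big_mkord size_sort size_map size_enum_ord.
by rewrite sum1dep_card; apply: eq_card => i; rewrite !inE.
Qed.

(* The ordered eigenvalues of [A mu] are continuous in [mu]; [K] of them are
   positive at [a] and nonpositive at [b], hence vanish in between. *)
Lemma spectral_flow n (A : R -> 'M[C]_n) a b L K p (W : 'M[C]_(p, n)) :
  a <= b -> (forall mu, (A mu)^t* = A mu) ->
  (forall mu nu x, mu <= b -> nu <= b ->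
    hform (A mu) x <= hform (A nu) x + L * `|mu - nu| * sqnorm x) ->
  (forall x, x != 0 -> 0 < hform (A a) x) ->
  (K <= \rank W)%N ->
  (forall x : 'rV[C]_n, (x <= W)%MS -> hform (A b) x <= 0) ->
  exists m : 'I_K -> R, (forall j, m j <= b) /\
    forall mu, (#|[set j | m j == mu]%SET| <= \rank (kermx (A mu)))%N.
Proof.
move=> ab Ah AL Aa KW Ab.
have Kn : (K <= n)%N by apply: leq_trans KW (rank_leq_col _).
(* One crossing is chosen for each [j]. Indices crossing at the same [mu] are distinct positions of
   0 among the ordered eigenvalues of [A mu], so multiplicities come out right. *)
suff /choice[m mP] : forall j : 'I_K, exists mu, mu <= b /\ ev (A mu) j = 0.
  exists m; split=> [j|mu]; first by have [] := mP j.
  apply: leq_trans (ev_eq0_card (Ah mu)).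
  have winj : injective (widen_ord Kn) by move=> i j /(congr1 val)/= /val_inj.
  rewrite -(card_imset _ winj) subset_leq_card //.
  apply/fintype.subsetP => _ /imsetP[j jm ->].
  by move: jm; rewrite !inE /= => /eqP <-; have [_ ->] := mP j.
move=> j; have jn : (j < n)%N by apply: leq_trans Kn.
have ea : 0 < ev (A a) j.
  rewrite ltNge; apply/negP => /(ev_le _ (Ah a) jn)[V jV Vle].
  have : V != 0 by rewrite -mxrank_eq0 -lt0n (leq_ltn_trans _ jV).
  move=> /rowV0Pn[x xV x0]; have := Vle x xV.
  by rewrite mul0r leNgt Aa.
have eb : ev (A b) j <= 0.
  apply/(ev_le _ (Ah b) jn); exists <<W>>%MS.
    by rewrite mxrank_gen (leq_trans (ltn_ord j)).
  by move=> x; rewrite genmxE mul0r; exact: Ab.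
have lip mu nu : mu <= b -> nu <= b -> ev (A mu) j <= ev (A nu) j + `|L| * `|mu - nu|.
  move=> mub nub; apply: ev_lipschitz => // x.
  rewrite (le_trans (AL mu nu x mub nub)) // lerD2l ler_wpM2r ?sqnorm_ge0 //.
  by rewrite ler_wpM2r // ler_norm.
have cont : {within `[a, b], continuous (fun mu => ev (A mu) j)}.
  apply/subspace_continuousP => mu; rewrite /= in_itv /= => /andP[_ mub].
  apply/cvgrPdist_le => e e0; near=> nu.
  have nub : nu <= b.
    near: nu; apply: (@filterS _ _ _ `[a, b]%classic); last exact: withinT.
    by move=> y /=; rewrite in_itv /= => /andP[].
  have : `|L| * `|mu - nu| <= e.
    (* The added 1 keeps the divisor nonzero when [L] is zero. *)
    rewrite (@le_trans _ _ ((`|L| + 1) * `|mu - nu|)) ?ler_wpM2r ?lerDl //.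
    rewrite -ler_pdivlMl ?ltr_wpDl // ltW //.
    near: nu; apply: cvg_within; apply: nbhsx_ballx.
    by rewrite mulr_gt0 ?invr_gt0 ?ltr_wpDl.
  have := lip _ _ mub nub; have := lip _ _ nub mub; rewrite (distrC nu) => l1 l2 Le.
  by rewrite ler_norml /from_subspace; apply/andP; split; lra.
have [|mu + E] := IVT (v := 0) ab cont.
  by rewrite ge_min eb orbT le_max (ltW ea).
by rewrite in_itv /= => /andP[_ mub]; exists mu.
Unshelve. all: by end_near. Qed.

End HermitianForms.

(** * Weak solutions on an edge *)

Section WeakSolutions.
Variable R : realType.
Local Notation C := R[i].
Local Notation leb := (@lebesgue_measure R).

Lemma continuous_integrable (l : R) (g : R -> R) : {within `[0, l], continuous g} ->
  leb.-integrable `[0, l] (EFin \o g).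
Proof. by move=> cg; apply: continuous_compact_integrable => //; exact: segment_compact. Qed.

Lemma primitive_continuous (l : R) (g h : R -> R) : 0 < l ->
  leb.-integrable `[0, l] (EFin \o h) ->
  (forall x, x \in `[0, l] -> g x = g 0 + \int[leb]_(y in `[0, x]) h y) ->
  {within `[0, l], continuous g}.
Proof.
move=> l0 ih gE.
have := parameterized_integral_continuous (ltW l0) ih.
move=> cint; apply: (@subspace_eq_continuous _ _ _
  (fun x => g 0 + parameterized_integral leb 0 x h)).
  by move=> x /set_mem xl; apply/esym/gE.
by move=> x; apply: cvgD; [exact: cvg_cst|exact: cint].
Qed.

Lemma primitive_derive (l : R) (g h : R -> R) : 0 < l ->
  {within `[0, l], continuous h} ->
  (forall x, x \in `[0, l] -> g x = g 0 + \int[leb]_(y in `[0, x]) h y) ->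
  forall x, x \in `]0, l[ -> is_derive x 1 g (h x).
Proof.
move=> l0 ch gE x xl; have := xl; rewrite in_itv /= => /andP[x0 xltl].
have [ch' _ _] := (continuous_within_itvP h l0).1 ch.
have [dF F'] := continuous_FTC1_closed xltl (continuous_integrable ch) x0 (ch' x xl).
suff dG : is_derive x 1 (fun x => g 0 + \int[leb]_(y in `[0, x]) h y : R) (h x).
  apply: near_eq_is_derive dG.
  near=> y; apply/esym/gE; rewrite in_itv /=; apply/andP; split; apply: ltW; near: y.
    exact: lt_nbhsr.
  exact: lt_nbhsl.
rewrite -[h x]add0r; apply: is_deriveD.
by split=> //; rewrite -F' derive1E.
Unshelve. all: by end_near. Qed.

(** Regularity is bootstrapped: integrability of [g2] makes [g1], hence [g], continuous; then [g2]
    may be replaced under the integral by the continuous [- k * g], and [wave_unique] applies. *)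
Lemma weak_wave (k l : R) (g g1 g2 : R -> R) : 0 < l ->
  leb.-integrable `[0, l] (EFin \o g2) ->
  (forall x, x \in `[0, l] -> g x = g 0 + \int[leb]_(y in `[0, x]) g1 y) ->
  (forall x, x \in `[0, l] -> g1 x = g1 0 + \int[leb]_(y in `[0, x]) g2 y) ->
  (\forall x \ae leb, x \in `[0, l] -> g2 x = - k * g x) ->
  forall x, x \in `[0, l] ->
  g x = g 0 * cosm k x + g1 0 * sinm k x /\
  g1 x = - k * g 0 * sinm k x + g1 0 * cosm k x.
Proof.
move=> l0 ig2 gE g1E g2E.
have cg1 := primitive_continuous l0 ig2 g1E.
have cg := primitive_continuous l0 (continuous_integrable cg1) gE.
have ckg : {within `[0, l], continuous (fun x => - k * g x)}.
  by move=> x; apply: cvgM; [exact: cvg_cst|exact: cg].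
have g1E' x : x \in `[0, l] -> g1 x = g1 0 + \int[leb]_(y in `[0, x]) (- k * g y).
  move=> xl; rewrite g1E //; congr (_ + fine _).
  have sub : `[0, x] `<=` `[0, l].
    move=> y /=; move: xl; rewrite !in_itv/= => /andP[_ xl] /andP[-> /le_trans]; exact.
  apply: ae_eq_integral => //.
  - suff /integrableP[] : leb.-integrable `[0, x] (EFin \o g2) by [].
    by apply: integrableS ig2 => //.
  - suff /integrableP[] : leb.-integrable `[0, x] (EFin \o (fun y => - k * g y)) by [].
    by apply: integrableS (continuous_integrable ckg) => //.
  - move: g2E; apply: filterS; first exact: (ae_filter_ringOfSetsType leb).
    by move=> y yE /sub yl; rewrite /= yE.
apply: wave_unique => //.
- exact: primitive_derive.
- exact: primitive_derive.
Qed.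

(** L^2 lies in L^1 on a bounded interval, by [|a| <= 1 + a ^+ 2]. *)
Lemma measurable_fun_cint (l : R) (g : R -> C) : L2 l g ->
  leb.-integrable `[0, l] (EFin \o (fun x => complex.Re (g x))) /\
  leb.-integrable `[0, l] (EFin \o (fun x => complex.Im (g x))).
Proof.
move=> [mR mI ig].
have i1 : leb.-integrable `[0, l] (EFin \o (fun=> 1 : R)).
  by apply: continuous_integrable; apply: continuous_subspaceT => x; exact: cvg_cst.
have ig1 : leb.-integrable `[0, l]
    (fun x => (1 + (complex.Re (g x) ^+ 2 + complex.Im (g x) ^+ 2))%:E).
  exact: integrableD i1 ig.
have sq1 (a b : R) : `|a| <= 1 + (a ^+ 2 + b ^+ 2).
  have : `|a| <= 1 + a ^+ 2.
    rewrite -(real_normK (num_real a)); have := sqr_ge0 (`|a| - 1).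
    by rewrite sqrrB1 mulr2n; have := normr_ge0 a; lra.
  by have := sqr_ge0 b; lra.
split; apply: le_integrable ig1 => //.
- by apply/measurable_EFinP.
- move=> x _ /=; rewrite lee_fin [leRHS]ger0_norm ?sq1 //.
  by rewrite !addr_ge0 ?sqr_ge0.
- by apply/measurable_EFinP.
- move=> x _ /=; rewrite lee_fin [leRHS]ger0_norm.
    by rewrite [complex.Re _ ^+ 2 + _]addrC sq1.
  by rewrite !addr_ge0 ?sqr_ge0.
Qed.

Lemma complexP (z w : C) : complex.Re z = complex.Re w -> complex.Im z = complex.Im w -> z = w.
Proof. by case: z => a b; case: w => c d /= -> ->. Qed.

Lemma ReMr (z : C) (r : R) : complex.Re (z * r%:C) = complex.Re z * r.
Proof. by case: z => a b /=; rewrite mulr0 subr0. Qed.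

Lemma ImMr (z : C) (r : R) : complex.Im (z * r%:C) = complex.Im z * r.
Proof. by case: z => a b /=; rewrite mulr0 add0r. Qed.

(** Real functions with complex coefficients: real and imaginary parts are real combinations and,
    [k] being real, each solves the equation separately. *)
Definition lincomb (g h : R -> R) (a b : C) (x : R) : C := a * (g x)%:C + b * (h x)%:C.

Lemma Re_lincomb g h a b x :
  complex.Re (lincomb g h a b x) = complex.Re a * g x + complex.Re b * h x.
Proof. by rewrite ReD !ReMr. Qed.

Lemma Im_lincomb g h a b x :
  complex.Im (lincomb g h a b x) = complex.Im a * g x + complex.Im b * h x.
Proof. by rewrite ImD !ImMr. Qed.

Lemma H2_wave (k l : R) (f f1 f2 : R -> C) : 0 < l -> H2 l f f1 f2 ->
  (\forall x \ae leb, x \in `[0, l] -> k%:C * f x = - f2 x) ->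
  forall x, x \in `[0, l] ->
  f x = lincomb (cosm k) (sinm k) (f 0) (f1 0) x /\
  f1 x = lincomb (fun x => - k * sinm k x) (cosm k) (f 0) (f1 0) x.
Proof.
move=> l0 [fE f1E /measurable_fun_cint[iR iI]] f2E x xl.
have h0R y : y \in `[0, l] -> complex.Re (f y) =
    complex.Re (f 0) + \int[leb]_(z in `[0, y]) complex.Re (f1 z).
  by move=> yl; rewrite fE // ReD.
have h1R y : y \in `[0, l] -> complex.Re (f1 y) =
    complex.Re (f1 0) + \int[leb]_(z in `[0, y]) complex.Re (f2 z).
  by move=> yl; rewrite f1E // ReD.
have h2R : \forall y \ae leb, y \in `[0, l] -> complex.Re (f2 y) = - k * complex.Re (f y).
  move: f2E; apply: filterS; first exact: (ae_filter_ringOfSetsType leb).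
  move=> y yE /yE /(congr1 (fun z => complex.Re (- z))).
  by rewrite opprK => <-; rewrite mulrC -mulNr ReMr; case: (f y) => a b /=; ring.
have [ER ER1] := weak_wave l0 iR h0R h1R h2R xl.
have h0I y : y \in `[0, l] -> complex.Im (f y) =
    complex.Im (f 0) + \int[leb]_(z in `[0, y]) complex.Im (f1 z).
  by move=> yl; rewrite fE // ImD.
have h1I y : y \in `[0, l] -> complex.Im (f1 y) =
    complex.Im (f1 0) + \int[leb]_(z in `[0, y]) complex.Im (f2 z).
  by move=> yl; rewrite f1E // ImD.
have h2I : \forall y \ae leb, y \in `[0, l] -> complex.Im (f2 y) = - k * complex.Im (f y).
  move: f2E; apply: filterS; first exact: (ae_filter_ringOfSetsType leb).
  move=> y yE /yE /(congr1 (fun z => complex.Im (- z))).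
  by rewrite opprK => <-; rewrite mulrC -mulNr ImMr; case: (f y) => a b /=; ring.
have [EI EI1] := weak_wave l0 iI h0I h1I h2I xl.
by split; apply: complexP; rewrite ?Re_lincomb ?Im_lincomb ?ER ?EI ?ER1 ?EI1 //; ring.
Qed.

Lemma Rintegral_derive (g h : R -> R) x : 0 <= x -> continuous h ->
  (forall y : R, is_derive y 1 g (h y)) ->
  g x = g 0 + \int[leb]_(y in `[0, x]) h y.
Proof.
rewrite le_eqVlt => /predU1P[<-|x0] ch dg.
  by rewrite set_itv1 Rintegral_set1 addr0.
have dg' y : derivable g y 1 by have [] := dg y.
have cg y : {for y, continuous g}.
  by apply/differentiable_continuous/derivable1_diffP.
rewrite /Rintegral (@continuous_FTC2 _ h g) //=.
- by ring.
- by apply: continuous_subspaceT => y; exact: ch.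
- split=> //; first exact/cvg_at_right_filter/cg.
  exact/cvg_at_left_filter/cg.
- by move=> y _; rewrite derive1E; have [_ ->] := dg y.
Qed.

Lemma lincomb_continuous (g h : R -> R) (p q : R) : continuous g -> continuous h ->
  continuous (fun x => p * g x + q * h x).
Proof.
move=> cg ch y; apply: cvgD; apply: cvgM; first exact: cvg_cst.
- exact: cg.
- exact: cvg_cst.
- exact: ch.
Qed.

Lemma lincomb_cint (g h g1 h1 : R -> R) a b x : 0 <= x ->
  continuous g1 -> continuous h1 ->
  (forall y : R, is_derive y 1 g (g1 y)) -> (forall y : R, is_derive y 1 h (h1 y)) ->
  lincomb g h a b x = lincomb g h a b 0 + cint x (lincomb g1 h1 a b).
Proof.
move=> x0 cg ch dg dh.
have main (p q : R) : p * g x + q * h x =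
    p * g 0 + q * h 0 + \int[leb]_(y in `[0, x]) (p * g1 y + q * h1 y).
  have dm (y : R) : is_derive y 1 (fun x => p * g x + q * h x) (p * g1 y + q * h1 y).
    have ? := dg y; have ? := dh y.
    by apply: is_derive_eq; rewrite /GRing.scale/=; ring.
  exact: (Rintegral_derive x0 (lincomb_continuous cg ch) dm).
apply: complexP.
  rewrite [in RHS]ReD !Re_lincomb main; congr (_ + _); rewrite /cint /=.
  by apply: eq_Rintegral => y _; rewrite Re_lincomb.
rewrite [in RHS]ImD !Im_lincomb main; congr (_ + _); rewrite /cint /=.
by apply: eq_Rintegral => y _; rewrite Im_lincomb.
Qed.

Lemma L2_lincomb (g h : R -> R) a b l : continuous g -> continuous h ->
  L2 l (lincomb g h a b).
Proof.
move=> cg ch.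
have cR : continuous (fun x => complex.Re (lincomb g h a b x)).
  by under eq_fun do rewrite Re_lincomb; exact: lincomb_continuous.
have cI : continuous (fun x => complex.Im (lincomb g h a b x)).
  by under eq_fun do rewrite Im_lincomb; exact: lincomb_continuous.
split.
- by apply: subspace_continuous_measurable_fun => //; exact: continuous_subspaceT.
- by apply: subspace_continuous_measurable_fun => //; exact: continuous_subspaceT.
apply: (continuous_integrable (g := fun x => complex.Re _ ^+ 2 + complex.Im _ ^+ 2)).
apply: continuous_subspaceT => x; apply: cvgD; rewrite expr2.
  by apply: cvgM; exact: cR.
by apply: cvgM; exact: cI.
Qed.

Lemma wave_H2 (k l : R) (a b : C) :
  H2 l (lincomb (cosm k) (sinm k) a b)
       (lincomb (fun x => - k * sinm k x) (cosm k) a b)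
       (lincomb (fun x => - k * cosm k x) (fun x => - k * sinm k x) a b).
Proof.
have cs : continuous (fun x => - k * sinm k x).
  by move=> y; apply: cvgM; [exact: cvg_cst|exact: sinm_continuous].
have cc : continuous (fun x => - k * cosm k x).
  by move=> y; apply: cvgM; [exact: cvg_cst|exact: cosm_continuous].
split=> [x /[!in_itv]/= /andP[x0 _]|x /[!in_itv]/= /andP[x0 _]|].
- apply: lincomb_cint => //; first exact: cosm_continuous.
    exact: is_derive_cosm.
  exact: is_derive_sinm.
- apply: lincomb_cint => // y; last exact: is_derive_cosm.
  have ? := is_derive_sinm k y.
  by apply: is_derive_eq; rewrite /GRing.scale/=; ring.
- exact: L2_lincomb.
Qed.

Lemma ae0_continuous (g : R -> R) l : 0 < l -> continuous g ->
  (\forall x \ae leb, x \in `[0, l] -> g x = 0) ->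
  forall x, x \in `[0, l] -> g x = 0.
Proof.
move=> l0 cg [A [mA A0 gA]] x; rewrite in_itv /= => /andP[x0 xl].
apply/eqP/negP => /negP gx0.
have /cvgr_neq0 /(_ gx0) [e /= e0 ne0] := cg x.
(* A neighbourhood of [x], clipped to [[0, l]] because [x] may be an end point. *)
pose p := Num.max 0 (x - e / 2); pose q := Num.min l (x + e / 2).
have pq : p < q.
  by rewrite lt_min !gt_max l0 /=; apply/and3P; split; lra.
have : (leb `[p, q] <= leb A)%E.
  apply: le_measure; rewrite ?inE //; apply: subset_trans gA => y /=.
  rewrite in_itv /= ge_max le_min => /andP[/andP[y0 xy] /andP[yl yx]].
  move=> H; have := ne0 y; rewrite /= H ?eqxx; last by rewrite in_itv /= y0.
  by move=> N; have : false by [apply: N; rewrite /ball /= ltr_norml; lra].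
rewrite A0 lebesgue_measure_itv /= lte_fin pq -EFinB lee_fin.
by rewrite leNgt subr_gt0 pq.
Qed.

Lemma lincomb_ae0 k l a b : 0 < l ->
  (\forall x \ae leb, x \in `[0, l] -> lincomb (cosm k) (sinm k) a b x = 0) ->
  forall x, x \in `[0, l] -> lincomb (cosm k) (sinm k) a b x = 0.
Proof.
move=> l0 f0 x xl.
have cR : continuous (fun x => complex.Re (lincomb (cosm k) (sinm k) a b x)).
  under eq_fun do rewrite Re_lincomb.
  exact: lincomb_continuous (@cosm_continuous R k) (@sinm_continuous R k).
have cI : continuous (fun x => complex.Im (lincomb (cosm k) (sinm k) a b x)).
  under eq_fun do rewrite Im_lincomb.
  exact: lincomb_continuous (@cosm_continuous R k) (@sinm_continuous R k).
apply: complexP.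
  apply: (ae0_continuous l0 cR) => //.
  move: f0; apply: filterS; first exact: (ae_filter_ringOfSetsType leb).
  by move=> y yE /yE ->.
apply: (ae0_continuous l0 cI) => //.
move: f0; apply: filterS; first exact: (ae_filter_ringOfSetsType leb).
by move=> y yE /yE ->.
Qed.

End WeakSolutions.

(** * Negative subspaces of decreasing families of forms *)

Section MonotoneForms.
Variable R : realType.
Local Notation C := R[i].

Lemma mul_trC_kernel n p (A : 'M[C]_n) (z : 'M[C]_(p, n)) :
  A^t* = A -> z *m A = 0 -> A *m z^t* = 0.
Proof.
by move=> Ah zA; rewrite -{1}Ah -map_mxM -trmx_mul zA trmx0 map_mx0.
Qed.

Lemma hformD_kernel n (A : 'M[C]_n) (x z : 'rV[C]_n) :
  A^t* = A -> z *m A = 0 -> hform A (x + z) = hform A x.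
Proof.
move=> Ah zA; rewrite /hform mulmxDl zA addr0 linearD /= map_mxD mulmxDr.
by rewrite -[X in _ + X]mulmxA (mul_trC_kernel Ah zA) mulmx0 addr0.
Qed.

(* When [k] reaches an eigenvalue [l], the form is nonpositive on the sum of
   the previous space and the kernel of [A l], and negative right after. *)
Lemma negative_space n (A : R -> 'M[C]_n) b K (m : 'I_K -> R) :
  (forall k, (A k)^t* = A k) ->
  (forall k l x, k < l -> l <= b -> x != 0 -> hform (A l) x < hform (A k) x) ->
  (forall k, k < b -> (#|[set j | m j == k]%SET| <= \rank (kermx (A k)))%N) ->
  forall t, t <= b -> exists2 W : 'M[C]_n, (#|[set j | (m j < t)%R]%SET| <= \rank W)%N &
    forall x : 'rV[C]_n, (x <= W)%MS -> x != 0 -> hform (A t) x < 0.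
Proof.
move=> Ah Adecr Aker t.
have [s] := ubnP #|[set j | (m j < t)%R]%SET|; elim: s t => // s IH t cts tb.
have [/eqP|] := eqVneq #|[set j | (m j < t)%R]%SET| 0%N.
  rewrite cards_eq0 => /eqP ->; exists 0; rewrite ?cards0 // => x.
  by rewrite submx0 => ->.
rewrite -lt0n => /card_gt0P[j0]; rewrite inE => j0t.
(* The largest value below [t] is split off with all its repetitions; the induction is on the number
   of values below [t]. *)
pose j1 := [arg max_(j > j0 | m j < t) m j]%O.
have [j1t j1max] : m j1 < t /\ forall j, m j < t -> m j <= m j1.
  by rewrite /j1; case: arg_maxP => // i it imax; split.
set l := m j1 in j1t j1max.
have split_l : (#|[set j | (m j < t)%R]%SET| <=
    #|[set j | (m j < l)%R]%SET| + #|[set j | m j == l]%SET|)%N.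
  rewrite -cardsUI (leq_trans _ (leq_addr _ _)) // subset_leq_card //.
  by apply/fintype.subsetP => j; rewrite !inE => /j1max; rewrite le_eqVlt orbC.
have l_lt : (#|[set j | (m j < l)%R]%SET| < #|[set j | (m j < t)%R]%SET|)%N.
  apply: proper_card; apply/properP; split.
    by apply/fintype.subsetP => j; rewrite !inE => /lt_trans; apply.
  by exists j1; rewrite !inE ?ltxx.
have lb : l < b by apply: lt_le_trans tb.
have [W rW Wneg] := IH l (leq_trans l_lt cts) (ltW lb).
exists (W + kermx (A l))%MS.
  rewrite (leq_trans split_l) // (leq_trans (leq_add rW (Aker l lb))) //.
  rewrite -mxrank_sum_cap -[leqRHS]addn0 leq_add2l leqn0 mxrank_eq0.
  (* The sum is direct: the form of [A l] vanishes on the kernel and is negative on nonzero vectors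
     of [W]. *)
  apply/rowV0P => x; rewrite sub_capmx => /andP[xW /sub_kermxP xk].
  have [//|x0] := eqVneq x 0; have := Wneg x xW x0.
  by rewrite /hform xk mul0mx mxE ltxx.
move=> x /sub_addsmxP[[u v] /= xE] x0.
apply: (lt_le_trans (Adecr l t x j1t tb x0)).
have vk : v *m kermx (A l) *m A l = 0 by rewrite -mulmxA mulmx_ker mulmx0.
rewrite xE hformD_kernel //.
have [->|uW0] := eqVneq (u *m W) 0; first by rewrite /hform !mul0mx mxE.
by rewrite ltW // Wneg // submxMl.
Qed.

Lemma hform_lower n (A : 'M[C]_n) : A^t* = A ->
  exists2 L, 0 <= L & forall x, - L * sqnorm x <= hform A x.
Proof.
move=> Ah; have [P Pu PA] := spectral_decomp Ah.
pose d i := complex.Re (spectral_diag A 0 i).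
exists (\sum_i `|d i|) => [|x]; first by rewrite sumr_ge0.
have -> : x = x *m P^t* *m P by rewrite mulmxKtV.
rewrite sqnorm_unitary // (hform_diag _ Pu PA) mulNr -subr_ge0 opprK.
rewrite mulr_suml -big_split /= sumr_ge0 // => i _.
have c0 := csq_ge0 ((x *m P^t* ) 0 i).
have : `|d i| * csq ((x *m P^t* ) 0 i) <= `|d i| * sqnorm (x *m P^t* ).
  rewrite ler_wpM2l // /sqnorm (bigD1 i) //= lerDl sumr_ge0 // => j _.
  exact: csq_ge0.
have : - `|d i| * csq ((x *m P^t* ) 0 i) <= d i * csq ((x *m P^t* ) 0 i).
  by rewrite ler_wpM2r // lerNl -normrN ler_norm.
by rewrite mulNr -/(d i); lra.
Qed.
End MonotoneForms.

(** * The Dirichlet-to-Neumann map of one piece *)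

Section Steps.
Variable R : realType.
Local Notation C := R[i].

Definition sol k (a b : C) : R -> C := lincomb (cosm k) (sinm k) a b.
Definition sol' k (a b : C) : R -> C := lincomb (fun x => - k * sinm k x) (cosm k) a b.

Lemma sol0 k (a b : C) : sol k a b 0 = a.
Proof. by rewrite /sol /lincomb cosm0 sinm0 mulr1 mulr0 addr0. Qed.

Lemma sol'0 k (a b : C) : sol' k a b 0 = b.
Proof. by rewrite /sol' /lincomb cosm0 sinm0 !mulr0 mulr1 add0r. Qed.

Lemma sol_shift k (a b : C) x h : 0 <= h ->
  sol k a b (x + h) = sol k a b x * (cosm k h)%:C + sol' k a b x * (sinm k h)%:C /\
  sol' k a b (x + h) =
    - (k%:C * sol k a b x * (sinm k h)%:C) + sol' k a b x * (cosm k h)%:C.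
Proof.
move=> h0; have [cE sE] := wave_add k x h0.
by rewrite /sol /sol' /lincomb cE sE; split; ring.
Qed.

(** The map from end values to outward derivatives, with even part [p] and odd part [q], tested on
    the two basic solutions: [(1, c2)] goes to [(0, - k * s2)] and [(0, s2)] to [(-1, c2)]. These
    are double-angle formulas at [tau + tau]. *)
Lemma dtn_step (k tau : R) (c2 := cosm k (tau + tau)) (s2 := sinm k (tau + tau))
    (p := even_dtn k tau / 2) (q := odd_dtn k tau / 2) : short k tau ->
  [/\ p * (1 + c2) + q * (1 - c2) = 0, (p - q) * s2 = -1,
      p * (1 + c2) - q * (1 - c2) = - k * s2 & (p + q) * s2 = c2].
Proof.
move=> st; have c0 := cosm_gt0 st; have s0 := sinm_tau_gt0 st.
have [cE sE] := wave_add k tau (ltW st.1).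
have := cosm_sinm_id k tau.
rewrite /p /q /c2 /s2 cE sE /even_dtn /odd_dtn.
move: (cosm k tau) (sinm k tau) c0 s0 => c s c0 s0 id1.
have cn : c != 0 by rewrite gt_eqF.
have sn : s != 0 by rewrite gt_eqF.
have -> : c * c = 1 - k * s ^+ 2 by rewrite -id1; ring.
have e1 : 1 + (1 - k * s ^+ 2 - k * s * s) = c ^+ 2 *+ 2 by rewrite -id1; ring.
have e2 : 1 - (1 - k * s ^+ 2 - k * s * s) = k * s ^+ 2 *+ 2 by ring.
have e3 : 1 - k * s ^+ 2 - k * s * s = c ^+ 2 - k * s ^+ 2 by rewrite -id1; ring.
split.
- by rewrite e1 e2; field; rewrite ?cn ?sn.
- have -> : -1 = - (c ^+ 2 + k * s ^+ 2) :> R by rewrite id1.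
  by field; rewrite ?cn ?sn.
- by rewrite e1 e2; field; rewrite ?cn ?sn.
- by rewrite e3; field; rewrite ?cn ?sn.
Qed.

(* [l] and the second left-hand side are the derivatives at the ends of the
   solution with end values [x0] and [x1]. *)
Lemma dtn_flux (k tau : R) (x0 x1 : C)
    (p := (even_dtn k tau / 2)%:C) (q := (odd_dtn k tau / 2)%:C)
    (l := - (p * (x0 + x1) + q * (x0 - x1))) : short k tau ->
  x1 = x0 * (cosm k (tau + tau))%:C + l * (sinm k (tau + tau))%:C /\
  p * (x0 + x1) - q * (x0 - x1) =
    - (k%:C * x0 * (sinm k (tau + tau))%:C) + l * (cosm k (tau + tau))%:C.
Proof.
move=> st; have [E1 E2 E3 E4] := dtn_step st.
move: E1 E2 E3 E4; rewrite {}/l {}/p {}/q.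
move: (cosm k _) (sinm k _) (even_dtn k tau / 2) (odd_dtn k tau / 2) => c s p q E1 E2 E3 E4.
have x1E : x1 = x0 * c%:C + - (p%:C * (x0 + x1) + q%:C * (x0 - x1)) * s%:C.
  rewrite -E4 (_ : _ + _ = - x1 * ((p - q) * s)%:C); last by ring.
  by rewrite E2; ring.
split=> //; move: x1E; move: (- (_ + _)) => l ->.
rewrite [LHS](_ : _ =
  x0 * (p * (1 + c) - q * (1 - c))%:C + l * ((p + q) * s)%:C); last by ring.
by rewrite E3 E4; ring.
Qed.

(** Converse of [dtn_flux]: for an actual solution, the two combinations of end values are its
    outward derivatives. *)
Lemma flux_sol (k tau : R) (a b : C) (t : R)
    (p := (even_dtn k tau / 2)%:C) (q := (odd_dtn k tau / 2)%:C)
    (x0 := sol k a b t) (x1 := sol k a b (t + (tau + tau))) : short k tau ->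
  p * (x0 + x1) + q * (x0 - x1) = - sol' k a b t /\
  p * (x0 + x1) - q * (x0 - x1) = sol' k a b (t + (tau + tau)).
Proof.
move=> st; have [E1 E2 E3 E4] := dtn_step st.
have [x1E ->] := sol_shift k a b t (addr_ge0 (ltW st.1) (ltW st.1)).
rewrite {}/x1 {}x1E {}/x0; move: E1 E2 E3 E4; rewrite {}/p {}/q.
move: (sol k a b t) (sol' k a b t) => x y.
move: (cosm k _) (sinm k _) (even_dtn k tau / 2) (odd_dtn k tau / 2) => c s p q E1 E2 E3 E4.
split.
  rewrite [LHS](_ : _ =
    x * (p * (1 + c) + q * (1 - c))%:C + y * ((p - q) * s)%:C); last by ring.
  by rewrite E1 E2; ring.
rewrite [LHS](_ : _ =
  x * (p * (1 + c) - q * (1 - c))%:C + y * ((p + q) * s)%:C); last by ring.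
by rewrite E3 E4; ring.
Qed.

End Steps.

(** * The nodal quadratic form *)

Section Discrete.
Variables (R : realType) (G : metric_graph R) (n : nat).
Variable c : forall v : vert G, vcond R (deg v).
Local Notation C := R[i].

(** Each edge has its own [n + 1] nodes, ends included; ends meeting at a vertex are not identified,
    since vertex conditions need not impose continuity. *)
Definition nodes := #|{: edge G * 'I_n.+1}|.

(** For [i > n], [inord] falls back to 0; hence the guards [i <= n] below. *)
Definition nval (x : 'rV[C]_nodes) (e : edge G) (i : nat) : C :=
  x 0 (enum_rank (e, inord i)).

Definition node_at (p : 'I_nodes) : edge G * 'I_n.+1 := enum_val p.

Definition sample (f : edge G -> nat -> C) : 'rV[C]_nodes :=
  \row_p f (node_at p).1 (node_at p).2.

Lemma nval_sample f e i : (i <= n)%N -> nval (sample f) e i = f e i.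
Proof. by move=> ile; rewrite /nval mxE /node_at enum_rankK /= inordK. Qed.

Lemma nval_eq x y : (forall e i, (i <= n)%N -> nval x e i = nval y e i) -> x = y.
Proof.
move=> xy; apply/rowP => p; rewrite -(enum_valK p).
case: (enum_val p) => e i; have := xy e i; rewrite /nval inord_val.
by apply; rewrite -ltnS.
Qed.

Lemma nvalD x y e i : nval (x + y) e i = nval x e i + nval y e i.
Proof. by rewrite /nval mxE. Qed.

Lemma nvalZ a x e i : nval (a *: x) e i = a * nval x e i.
Proof. by rewrite /nval mxE. Qed.

Definition endval (x : 'rV[C]_nodes) (h : edge G + edge G) : C :=
  match h with inl e => nval x e 0 | inr e => nval x e n end.

Definition trace (x : 'rV[C]_nodes) v : 'cV[C]_(deg v) :=
  \col_j endval x (enum_val j).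

(** Half the length of a piece, matching the interval [[-tau, tau]] of [even_dtn] and [odd_dtn]. *)
Definition halfstep (e : edge G) : R := len e / (n%:R + n%:R).

(** The even part of a piece takes the value [(x0 + x1) / 2] at both ends and contributes
    [even_dtn * |x0 + x1| ^ 2 / 2]; similarly for the odd part. This explains the halves. *)
Definition energy k (x y : 'rV[C]_nodes) : C :=
  \sum_e \sum_(i < n)
    ((even_dtn k (halfstep e) / 2)%:C * (nval x e i + nval x e i.+1) *
        (nval y e i + nval y e i.+1)^*%R +
     (odd_dtn k (halfstep e) / 2)%:C * (nval x e i - nval x e i.+1) *
        (nval y e i - nval y e i.+1)^*%R).

Definition vform (x y : 'rV[C]_nodes) : C :=
  \sum_v ((trace y v)^t* *m cL (c v) *m trace x v) 0 0.

(* The quadratic form of [H - k] on the functions solving [- u'' = k u]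
   between consecutive nodes, in terms of the nodal values. *)
Definition gform k x y : C := energy k x y + vform x y.

Lemma endvalD x y h : endval (x + y) h = endval x h + endval y h.
Proof. by case: h => e /=; rewrite nvalD. Qed.

Lemma endvalZ a x h : endval (a *: x) h = a * endval x h.
Proof. by case: h => e /=; rewrite nvalZ. Qed.

Lemma trace_linear a x y v : trace (a *: x + y) v = a *: trace x v + trace y v.
Proof. by apply/colP => j; rewrite !mxE endvalD endvalZ. Qed.

Lemma gform_linear k a x x' y :
  gform k (a *: x + x') y = a * gform k x y + gform k x' y.
Proof.
rewrite /gform /energy /vform mulrDr addrACA; congr (_ + _).
  rewrite mulr_sumr -big_split /=; apply: eq_bigr => e _.
  rewrite mulr_sumr -big_split /=; apply: eq_bigr => i _.
  by rewrite !nvalD !nvalZ; ring.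
rewrite mulr_sumr -big_split /=; apply: eq_bigr => v _.
by rewrite trace_linear mulmxDr -scalemxAr mxE [X in X + _]mxE.
Qed.

Lemma conj_real (r : R) : (r%:C)^*%R = r%:C.
Proof. exact: conjc_real. Qed.

Hypothesis cL_herm' : forall v, (cL (c v))^t* = cL (c v).

Lemma gform_conj k x y : gform k x y = (gform k y x)^*%R.
Proof.
rewrite /gform /energy /vform rmorphD !rmorph_sum; congr (_ + _).
  apply: eq_bigr => e _; rewrite rmorph_sum; apply: eq_bigr => i _.
  rewrite !(rmorphD, rmorphM, rmorphB) /= !conjCK !conj_real.
  by ring.
apply: eq_bigr => v _.
have conj11 (M : 'M[C]_1) : (M 0 0)^*%R = (M^t* ) 0 0 by rewrite !mxE.
rewrite /= [RHS]conj11.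
by rewrite !trmx_mul !map_mxM trmxCK cL_herm' mulmxA.
Qed.

Definition genergy k (x : 'rV[C]_nodes) : R :=
  \sum_e \sum_(i < n)
    (even_dtn k (halfstep e) / 2 * csq (nval x e i + nval x e i.+1) +
     odd_dtn k (halfstep e) / 2 * csq (nval x e i - nval x e i.+1)).

Definition gvform (x : 'rV[C]_nodes) : R :=
  \sum_v hform (cL (c v)) ((trace x v)^t* ).

Lemma Re_term (p : R) (z : C) : complex.Re (p%:C * z * z^*%R) = p * csq z.
Proof. by rewrite -mulrA -csqE -rmorphM. Qed.

Lemma Re_gform k x : complex.Re (gform k x x) = genergy k x + gvform x.
Proof.
rewrite /gform ReD; congr (_ + _).
  rewrite Re_sum; apply: eq_bigr => e _; rewrite Re_sum; apply: eq_bigr => i _.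
  by rewrite ReD !Re_term.
rewrite Re_sum; apply: eq_bigr => v _.
by rewrite /hform trmxCK.
Qed.

Definition end_node (h : edge G + edge G) : edge G * 'I_n.+1 :=
  match h with inl e => (e, inord 0) | inr e => (e, inord n) end.

Definition trace_mx v : 'M[C]_(nodes, deg v) :=
  \matrix_(p, j) (p == enum_rank (end_node (enum_val j)))%:R.

Lemma trace_mxE x v : (x *m trace_mx v)^T = trace x v.
Proof.
apply/colP => j; rewrite !mxE.
pose q := enum_rank (end_node (enum_val j)).
rewrite (bigD1 q) //= mxE -/q eqxx mulr1 big1 ?addr0.
  by rewrite /q /endval /nval; case: (enum_val j).
by move=> p pq; rewrite mxE -/q (negPf pq) mulr0.
Qed.

(** Only the Dirichlet part constrains the form domain; the Neumann and Robin parts emerge from the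
    kernel as natural conditions. *)
Definition admissible x := forall v, cD (c v) *m trace x v = 0.

Definition dom_mx : 'M[C]_nodes := (\bigcap_v kermx (trace_mx v *m (cD (c v))^T))%MS.

Lemma dom_mxP x : (x <= dom_mx)%MS <-> admissible x.
Proof.
split=> [/sub_bigcapmxP xd v|xa].
  have /sub_kermxP := xd v isT; rewrite mulmxA => /(congr1 trmx).
  by rewrite trmx_mul trmxK trace_mxE trmx0.
apply/sub_bigcapmxP => v _; apply/sub_kermxP; rewrite mulmxA.
by apply: trmx_inj; rewrite trmx_mul trmxK trace_mxE trmx0 xa.
Qed.

(** Orthonormal rows, so that coordinates preserve [sqnorm] and the Lipschitz bound carries over to
    [gmx]. *)
Definition dom_basis : 'M[C]_(\rank dom_mx, nodes) := schmidt (row_base dom_mx).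

Lemma dom_basis_unitary : dom_basis \is unitarymx.
Proof. by apply: schmidt_unitarymx; exact: rank_leq_col. Qed.

Lemma dom_basisP x : (x <= dom_basis)%MS <-> admissible x.
Proof.
by rewrite -dom_mxP /dom_basis eqmx_schmidt_free ?row_base_free // eq_row_base.
Qed.

Lemma admissible_basis y : admissible (y *m dom_basis).
Proof. by apply/dom_basisP; exact: submxMl. Qed.

Definition gmx k : 'M[C]_(\rank dom_mx) :=
  \matrix_(i, j) gform k (row i dom_basis) (row j dom_basis).

Lemma gform0 k y : gform k 0 y = 0.
Proof.
by have := gform_linear k (-1) 0 0 y; rewrite scaler0 addr0 mulN1r addNr.
Qed.

Lemma gform_sum k m (a : 'I_m -> C) (x : 'I_m -> 'rV[C]_nodes) y :
  gform k (\sum_i a i *: x i) y = \sum_i a i * gform k (x i) y.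
Proof.
elim/big_rec2: _ => [|i u v _ <-]; first exact: gform0.
by rewrite gform_linear.
Qed.

Lemma gmxE k y z : (y *m gmx k *m z^t* ) 0 0 = gform k (y *m dom_basis) (z *m dom_basis).
Proof.
rewrite (mulmx_sum_row y dom_basis) (mulmx_sum_row z dom_basis) gform_sum mxE.
under eq_bigr do rewrite mxE mulr_suml.
rewrite exchange_big /=; apply: eq_bigr => i _.
rewrite gform_conj gform_sum rmorph_sum mulr_sumr; apply: eq_bigr => j _.
by rewrite !mxE rmorphM /= -gform_conj -!mulrA; congr (_ * _); rewrite mulrC.
Qed.

Lemma gmx_herm k : (gmx k)^t* = gmx k.
Proof. by apply/matrixP => i j; rewrite !mxE -gform_conj. Qed.

Lemma hform_gmx k y : hform (gmx k) y = genergy k (y *m dom_basis) + gvform (y *m dom_basis).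
Proof. by rewrite /hform gmxE Re_gform. Qed.

Lemma gmx_kerP k y : y *m gmx k = 0 <->
  forall z, admissible z -> gform k (y *m dom_basis) z = 0.
Proof.
split=> [yA z /dom_basisP/submxP[w ->]|yz].
  by rewrite -gmxE yA mul0mx mxE.
apply/rowP => j; rewrite [RHS]mxE.
have := yz _ (admissible_basis (delta_mx 0 j)); rewrite -gmxE => <-.
rewrite trmx_delta map_delta_mx -colE.
by rewrite !mxE.
Qed.

End Discrete.

(** * Dependence of the nodal form on the spectral parameter *)

Section Estimates.
Variables (R : realType) (G : metric_graph R) (n : nat).
Variable c : forall v : vert G, vcond R (deg v).
Local Notation C := R[i].
Local Notation tau := (halfstep n).
Hypothesis n_gt0 : (0 < n)%N.
Implicit Types x : 'rV[C]_(nodes G n).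

Lemma sum_ends (V : nmodType) (g : edge G + edge G -> V) :
  \sum_v \sum_(j < deg v) g (enum_val j) = \sum_e (g (inl e) + g (inr e)).
Proof.
rewrite big_split /= -(big_sumType _ (fun=> true) g) /=.
rewrite (partition_big (@end_vert R G) xpredT) //=; apply: eq_bigr => v _.
by rewrite /deg -big_enum_val; apply: eq_bigl => h; rewrite inE.
Qed.

Lemma sqnorm_nodes x : sqnorm x = \sum_e \sum_(i < n.+1) csq (nval x e i).
Proof.
rewrite pair_big /= /sqnorm (reindex (@enum_rank (edge G * 'I_n.+1)%type)) /=.
  by apply: eq_bigr => -[e i] _; rewrite /nval inord_val.
by apply: onW_bij; exact: enum_rank_bij.
Qed.

(** Interior nodes belong to two pieces, end nodes to one. *)
Lemma sum_steps (F : nat -> R) : (forall i, 0 <= F i) ->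
  \sum_(i < n.+1) F i <= \sum_(i < n) (F i + F i.+1) <= (\sum_(i < n.+1) F i) *+ 2.
Proof.
move=> F0.
have E1 : \sum_(i < n.+1) F i = \sum_(i < n) F i + F n by rewrite big_ord_recr.
have E2 : \sum_(i < n.+1) F i = F 0%N + \sum_(i < n) F i.+1 by rewrite big_ord_recl.
have := F0 0%N; have := F0 n; rewrite mulr2n big_split /=.
have : F n <= \sum_(i < n) F i.+1.
  case: n n_gt0 => // m _; rewrite big_ord_recr /= lerDr sumr_ge0 //.
by move=> ? ? ?; apply/andP; split; rewrite ?E2 -?E1; lra.
Qed.

Lemma csqDB (y z : C) : csq (y + z) + csq (y - z) = (csq y + csq z) *+ 2.
Proof. by case: y => a b; case: z => a' b'; rewrite /csq /=; ring. Qed.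

Section ShortEdges.
Variable b : R.
Hypothesis shortb : forall e : edge G, short b (tau e).

Lemma tau_gt0 (e : edge G) : 0 < tau e.
Proof. by have [] := shortb e. Qed.

Lemma genergy_lt k l x : k < l -> l <= b -> x != 0 -> genergy l x < genergy k x.
Proof.
move=> kl lb x0; rewrite -subr_gt0 /genergy -sumrB.
pose D e i := (even_dtn k (tau e) - even_dtn l (tau e)) / 2 * csq (nval x e i + nval x e i.+1)
  + (odd_dtn k (tau e) - odd_dtn l (tau e)) / 2 * csq (nval x e i - nval x e i.+1).
rewrite (eq_bigr (fun e => \sum_(i < n) D e i)); last first.
  by move=> e _; rewrite -sumrB; apply: eq_bigr => i _; rewrite /D; ring.
have pos (e : edge G) : 0 < (even_dtn k (tau e) - even_dtn l (tau e)) / 2 /\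
    0 < (odd_dtn k (tau e) - odd_dtn l (tau e)) / 2.
  have sl := short_le lb (shortb e).
  have /andP[? _] := even_dtn_lt kl sl; have /andP[? _] := odd_dtn_lt kl sl.
  by split; apply: divr_gt0.
have D0 e i : 0 <= D e i.
  by have [p q] := pos e; apply: addr_ge0; apply: mulr_ge0; rewrite ?csq_ge0 // ltW.
have S0 : 0 <= \sum_e \sum_(i < n) D e i.
  by apply: sumr_ge0 => e _; apply: sumr_ge0.
rewrite lt_neqAle S0 andbT.
(* Equality would make the sums and differences of neighbouring nodal values vanish, hence all nodal
   values. *)
rewrite eq_sym; apply: contra x0 => /eqP D00.
have D00' e (i : 'I_n) : D e i = 0.
  have De := psumr_eq0P (fun e _ => sumr_ge0 _ (fun (i : 'I_n) _ => D0 e i)) D00.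
  by apply: (psumr_eq0P (fun (i : 'I_n) _ => D0 e i) (De e isT)).
have zero e (i : 'I_n) : nval x e i = 0 /\ nval x e i.+1 = 0.
  have [p q] := pos e; have E : D e i = 0 := D00' e i.
  have h1 := mulr_ge0 (ltW p) (csq_ge0 (nval x e i + nval x e i.+1)).
  have h2 := mulr_ge0 (ltW q) (csq_ge0 (nval x e i - nval x e i.+1)).
  rewrite /D in E.
  move/eqP: E; rewrite (paddr_eq0 h1 h2) mulf_eq0 (gt_eqF p) mulf_eq0 (gt_eqF q) /= !csq_eq0.
  rewrite subr_eq0 => /andP[/eqP s /eqP E]; move: s; rewrite E -mulr2n => /eqP.
  by rewrite -mulr_natl mulf_eq0 pnatr_eq0 => /eqP.
(* Node [n] is reached only as the right end of the last piece. *)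
apply/eqP/nval_eq => e i; rewrite leq_eqVlt => /predU1P[->|ilt].
  have ltn : (n.-1 < n)%N by rewrite prednK.
  by have := zero e (Ordinal ltn); rewrite /= prednK // => -[_ ->]; rewrite /nval mxE.
by have [/= -> _] := zero e (Ordinal ilt); rewrite /nval mxE.
Qed.

Lemma dtn_lipschitz k l (e : edge G) : k <= b -> l <= b ->
  even_dtn k (tau e) <= even_dtn l (tau e) + 4 * tau e * `|k - l| /\
  odd_dtn k (tau e) <= odd_dtn l (tau e) + 4 * tau e * `|k - l|.
Proof.
move=> kb lb; have t0 := tau_gt0 e.
have [kl|lk|->] := ltgtP k l; last by rewrite subrr normr0 mulr0 !addr0.
- have sl := short_le lb (shortb e).
  have /andP[_ ?] := even_dtn_lt kl sl; have /andP[_ ?] := odd_dtn_lt kl sl.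
  by rewrite distrC gtr0_norm ?subr_gt0 //; split; lra.
- have sk := short_le kb (shortb e).
  have /andP[? _] := even_dtn_lt lk sk; have /andP[? _] := odd_dtn_lt lk sk.
  have : 0 <= 4 * tau e * `|k - l| by rewrite mulr_ge0 // mulr_ge0 // ltW.
  by split; lra.
Qed.

(** In [8 * tau e], the 4 of [dtn_lipschitz] is doubled because a node may belong to two pieces; the
    part of the norm on one edge is bounded by the whole. *)
Lemma genergy_lipschitz k l x : k <= b -> l <= b ->
  genergy k x <= genergy l x + (\sum_(e : edge G) 8 * tau e) * `|k - l| * sqnorm x.
Proof.
move=> kb lb; rewrite sqnorm_nodes.
set S := \sum_e \sum_(i < n.+1) _.
have SE e : \sum_(i < n.+1) csq (nval x e i) <= S.
  rewrite /S (bigD1 e) //= lerDl sumr_ge0 // => e' _.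
  by rewrite sumr_ge0 // => i _; exact: csq_ge0.
rewrite !mulr_suml /genergy -big_split /=; apply: ler_sum => e _.
have t0 := tau_gt0 e.
have [Ev Od] := dtn_lipschitz e kb lb.
apply: (@le_trans _ _ (\sum_(i < n)
    (even_dtn l (tau e) / 2 * csq (nval x e i + nval x e i.+1) +
     odd_dtn l (tau e) / 2 * csq (nval x e i - nval x e i.+1)) +
    4 * tau e * `|k - l| * \sum_(i < n) (csq (nval x e i) + csq (nval x e i.+1)))).
  rewrite mulr_sumr -big_split /=; apply: ler_sum => i _.
  have := csqDB (nval x e i) (nval x e i.+1); rewrite mulr2n.
  set P := csq (_ + _); set Q := csq (_ - _).
  have P0 : 0 <= P := csq_ge0 _; have Q0 : 0 <= Q := csq_ge0 _.
  move=> PQ; have -> : csq (nval x e i) + csq (nval x e i.+1) = P / 2 + Q / 2 by lra.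
  have := ler_wpM2r P0 Ev; have := ler_wpM2r Q0 Od; lra.
rewrite lerD2l.
have -> : 8 * tau e * `|k - l| * S = 4 * tau e * `|k - l| * (S *+ 2) by rewrite mulr2n; ring.
have c0 : 0 <= 4 * tau e * `|k - l| by rewrite mulr_ge0 // mulr_ge0 // ltW.
rewrite (ler_wpM2l c0) //.
have /andP[_ SS] := sum_steps (fun i => csq_ge0 (nval x e i)).
by apply: (le_trans SS); rewrite lerMn2r SE.
Qed.

End ShortEdges.

Hypothesis cL_herm' : forall v, (cL (c v))^t* = cL (c v).

Lemma sqnorm_trace_le x v : sqnorm ((trace x v)^t* ) <= sqnorm x *+ 2.
Proof.
have -> : sqnorm ((trace x v)^t* ) = \sum_(j < deg v) csq (endval x (enum_val j)).
  apply: eq_bigr => j _; rewrite !mxE.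
  by case: (endval _ _) => p q; rewrite /csq /= sqrrN.
have := sum_ends (fun h => csq (endval x h)); rewrite (bigD1 v) //= => E.
apply: (@le_trans _ _ (\sum_e (csq (nval x e 0) + csq (nval x e n)))).
  rewrite -E lerDl sumr_ge0 // => w _; rewrite sumr_ge0 // => j _; exact: csq_ge0.
rewrite sqnorm_nodes -sumrMnl; apply: ler_sum => e _; rewrite mulr2n lerD //.
  by rewrite big_ord_recl /= lerDl sumr_ge0 // => j _; exact: csq_ge0.
by rewrite big_ord_recr /= lerDr sumr_ge0 // => j _; exact: csq_ge0.
Qed.

Lemma gvform_lower : exists2 L, 0 <= L & forall x, - L * sqnorm x <= gvform c x.
Proof.
have /choice[L LP] : forall v, exists L, 0 <= L /\
    forall u, - L * sqnorm u <= hform (cL (c v)) u.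
  by move=> v; have [L L0 LP] := hform_lower (cL_herm' v); exists L.
exists (\sum_v L v *+ 2) => [|x].
  by rewrite sumr_ge0 // => v _; rewrite mulrn_wge0 //; have [] := LP v.
rewrite mulNr mulr_suml -sumrN; apply: ler_sum => v _.
have [L0 Lv] := LP v; apply: le_trans (Lv _).
rewrite mulNr lerN2 mulrnAl -mulrnAr ler_wpM2l //; exact: sqnorm_trace_le.
Qed.

Lemma genergy_ge M k x : 0 <= M ->
  (forall e : edge G, M <= even_dtn k (tau e) /\ M <= odd_dtn k (tau e)) ->
  M * sqnorm x <= genergy k x.
Proof.
move=> M0 Mle; rewrite sqnorm_nodes mulr_sumr; apply: ler_sum => e _.
have /andP[SS _] := sum_steps (fun i => csq_ge0 (nval x e i)).
apply: (le_trans (ler_wpM2l M0 SS)); rewrite mulr_sumr; apply: ler_sum => i _.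
have := csqDB (nval x e i) (nval x e i.+1); rewrite mulr2n.
set P := csq (_ + _); set Q := csq (_ - _).
have P0 : 0 <= P := csq_ge0 _; have Q0 : 0 <= Q := csq_ge0 _.
move=> PQ; have -> : csq (nval x e i) + csq (nval x e i.+1) = P / 2 + Q / 2 by lra.
have [Ev Od] := Mle e.
have := ler_wpM2r P0 Ev; have := ler_wpM2r Q0 Od; lra.
Qed.

Lemma gform_coercive b : (forall e : edge G, 0 < tau e) ->
  exists2 a, a <= b & forall x, x != 0 -> 0 < genergy a x + gvform c x.
Proof.
move=> t0; have [L L0 LP] := gvform_lower.
(* [dtn_ge] will be used with [M = L + 1]: [L] absorbs the vertex terms and 1 remains. [T] dominates
   [(tau e) ^- 2] for all edges at once. *)
pose T := \sum_(e : edge G) (tau e) ^- 2.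
pose a := Num.min b (- (2 * (L + 1) ^+ 2 + T)).
have L1 : 0 < L + 1 by lra.
exists a => [|x x0]; first by rewrite ge_min lexx.
have : (L + 1) * sqnorm x <= genergy a x.
  apply: genergy_ge => [|e]; first exact: ltW.
  apply: dtn_ge => //; rewrite /a ge_min; apply/orP; right.
  rewrite lerN2 lerD2l /T (bigD1 e) //= lerDl sumr_ge0 // => e' _.
  by rewrite -exprVn sqr_ge0.
have := LP x; have := sqnorm_gt0 x0; lra.
Qed.

End Estimates.

(** * Kernel of the nodal form and eigenfunctions *)

Section VertexOrthogonality.
Variables (R : realType) (d : nat) (c : vcond R d).
Local Notation C := R[i].
Hypothesis csa : selfadjoint_vcond c.

Lemma cLR : cL c *m cR c = cL c.
Proof. by rewrite -(cL_ran csa) -!mulmxA (projR csa).1. Qed.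

Lemma cRL : cR c *m cL c = cL c.
Proof. by rewrite -(cL_ran csa) !mulmxA (projR csa).1. Qed.

Lemma cNL : cN c *m cL c = 0.
Proof. by rewrite -(cL_ran csa) !mulmxA (orthNR csa) !mul0mx. Qed.

Lemma orth_sym (P Q : 'M[C]_d) : orth_proj P -> orth_proj Q -> P *m Q = 0 -> Q *m P = 0.
Proof.
move=> [_ Ph] [_ Qh] PQ.
by rewrite -Ph -Qh -map_mxM -trmx_mul PQ trmx0 map_mx0.
Qed.

(** [u] lies in the sum of the ranges of [cN c] and [cR c], and both projections annihilate the
    defect [cL c *m F - F']. *)
Lemma vsat_orth (F F' u : 'cV[C]_d) : vsat c F F' -> cD c *m u = 0 ->
  u^t* *m (cL c *m F - F') = 0.
Proof.
move=> [_ NF RF] Du.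
have uE : u = (cN c + cR c) *m u.
  by rewrite -[LHS]mul1mx -(projDNR csa) -addrA mulmxDl Du add0r.
have NRh : (cN c + cR c)^t* = cN c + cR c.
  by rewrite linearD /= map_mxD (projN csa).2 (projR csa).2.
rewrite uE trmx_mul map_mxM NRh.
rewrite -mulmxA mulmxDl !mulmxBr !mulmxA cNL cRL mul0mx NF RF mulmxA cLR.
by rewrite !subrr addr0 mulmx0.
Qed.

Lemma vsatP (F F' : 'cV[C]_d) (w := cL c *m F - F') (u := (1%:M - cD c) *m w) :
  cD c *m F = 0 -> u = 0 -> vsat c F F'.
Proof.
move=> DF; rewrite /u mulmxBl mul1mx => /subr0_eq wE.
have ND := orth_sym (projD csa) (projN csa) (orthDN csa).
have RD := orth_sym (projD csa) (projR csa) (orthDR csa).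
have Nw : cN c *m w = 0 by rewrite wE mulmxA ND mul0mx.
have Rw : cR c *m w = 0 by rewrite wE mulmxA RD mul0mx.
move: Nw Rw; rewrite /w !mulmxBr !mulmxA cNL cRL mul0mx sub0r => /eqP.
rewrite oppr_eq0 => /eqP NF /subr0_eq RF.
by split=> //; rewrite -RF mulmxA cLR.
Qed.

Lemma defect_admissible (w : 'cV[C]_d) : cD c *m ((1%:M - cD c) *m w) = 0.
Proof. by rewrite mulmxA mulmxBr mulmx1 (projD csa).1 subrr mul0mx. Qed.

(** Used as a test vector, the admissible part of the defect pairs with the defect to its own
    squared norm, so weak solutions have none. *)
Lemma defect_sqnorm (w : 'cV[C]_d) (u := (1%:M - cD c) *m w) :
  (u^t* *m w) 0 0 = (sqnorm (u^t* ))%:C.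
Proof.
have [DD Dh] := projD csa.
have Eh : (1%:M - cD c)^t* = 1%:M - cD c by rewrite linearB /= map_mxB trmx1 map_mx1 Dh.
have EE : (1%:M - cD c) *m (1%:M - cD c) = 1%:M - cD c.
  by rewrite mulmxBr mulmx1 mulmxBl mul1mx DD subrr subr0.
rewrite sqnormE trmxCK /u trmx_mul map_mxM Eh; congr ((_ : 'M[C]_1) 0 0).
by rewrite -!mulmxA (mulmxA (1%:M - cD c)) EE.
Qed.

End VertexOrthogonality.

Section NodalSolutions.
Variables (R : realType) (G : metric_graph R) (n : nat).
Variable c : forall v : vert G, vcond R (deg v).
Local Notation C := R[i].
Local Notation tau := (halfstep n).
Hypothesis n_gt0 : (0 < n)%N.
Variable b : R.
Hypothesis shortb : forall e : edge G, short b (tau e).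
Implicit Types x y z : 'rV[C]_(nodes G n).

Definition point (e : edge G) (i : nat) : R := i%:R * (tau e + tau e).

Lemma point0 e : point e 0 = 0.
Proof. by rewrite /point mul0r. Qed.

Lemma pointS e i : point e i.+1 = point e i + (tau e + tau e).
Proof. by rewrite /point -natr1 mulrDl mul1r. Qed.

Lemma point_len e : point e n = len e.
Proof. by rewrite /point /halfstep; field; rewrite -mulr2n mulrn_eq0 /= pnatr_eq0 -lt0n. Qed.

Lemma point_in e i : (i <= n)%N -> point e i \in `[0, len e].
Proof.
move=> ile; have t0 := tau_gt0 shortb e; rewrite in_itv /= -(point_len e) /point.
by rewrite mulr_ge0 ?addr_ge0 ?(ltW t0) //= ler_wpM2r ?addr_ge0 ?(ltW t0) // ler_nat.
Qed.

(** Discrete Green formula: each piece contributes a difference of boundary terms at consecutive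
    nodes, and the sum telescopes. *)
Lemma energy_sol k (al be : edge G -> C) x y : k <= b ->
  (forall e i, (i <= n)%N -> nval x e i = sol k (al e) (be e) (point e i)) ->
  energy k x y = \sum_e (sol' k (al e) (be e) (len e) * (nval y e n)^*%R
                         - sol' k (al e) (be e) 0 * (nval y e 0)^*%R).
Proof.
move=> kb xE; apply: eq_bigr => e _.
rewrite -[in RHS](point_len e) -[X in _ - sol' k _ _ X * _](point0 e).
pose g i := sol' k (al e) (be e) (point e i) * (nval y e i)^*%R.
rewrite -(telescope_sumr g (leq0n n)) big_mkord; apply: eq_bigr => i _.
have st := short_le kb (shortb e).
rewrite (xE e i) 1?ltnW // (xE e i.+1) // pointS /g pointS.
have [E1 E2] := flux_sol (al e) (be e) (point e i) st.
rewrite -E2 -[sol' k (al e) (be e) (point e i)]opprK -E1.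
by rewrite rmorphD rmorphB /=; ring.
Qed.

Lemma trace_bvec (f : gfun G) x v :
  (forall h, endval x h = bval f h) -> trace x v = bvec f v.
Proof. by move=> xf; apply/colP => j; rewrite !mxE xf. Qed.

(** The end terms left by telescoping are regrouped by vertex and joined with [vform]; the result is
    the defect in the vertex conditions. *)
Lemma gform_sol k (f f1 : gfun G) x y : k <= b ->
  (forall e t, t \in `[0, len e] -> f e t = sol k (f e 0) (f1 e 0) t /\
                                   f1 e t = sol' k (f e 0) (f1 e 0) t) ->
  (forall e i, (i <= n)%N -> nval x e i = f e (point e i)) ->
  gform c k x y = \sum_v ((trace y v)^t* *m (cL (c v) *m bvec f v - bvec' f1 v)) 0 0.
Proof.
move=> kb fE xf.
have xE e i : (i <= n)%N -> nval x e i = sol k (f e 0) (f1 e 0) (point e i).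
  by move=> ile; rewrite xf // (fE e _ (point_in e ile)).1.
have xb h : endval x h = bval f h.
  by case: h => e /=; rewrite xf // ?point0 ?point_len.
rewrite /gform (energy_sol y kb xE) /vform addrC.
have len_in (e : edge G) : len e \in `[0, len e] by rewrite in_itv /= lexx ltW ?len_gt0.
transitivity (\sum_v ((trace y v)^t* *m cL (c v) *m trace x v) 0 0
   - \sum_v \sum_(j < deg v) bder f1 (enum_val j) * (endval y (enum_val j))^*%R).
  congr (_ + _); rewrite (sum_ends (fun h => bder f1 h * (endval y h)^*%R)) -sumrN.
  apply: eq_bigr => e _ /=; rewrite (fE e _ (len_in e)).2 sol'0.
  by rewrite mulNr opprD opprK addrC.
rewrite -sumrB; apply: eq_bigr => v _; rewrite mulmxBr [in RHS]mxE mulmxA (trace_bvec v xb).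
congr (_ + _); rewrite [in RHS]mxE; congr (- _).
by rewrite mxE; apply: eq_bigr => j _; rewrite !mxE mulrC.
Qed.

End NodalSolutions.

Section KernelSolutions.
Variables (R : realType) (G : metric_graph R) (n : nat).
Variable c : forall v : vert G, vcond R (deg v).
Local Notation C := R[i].
Local Notation tau := (halfstep n).
Local Notation point := (point n).
Hypothesis n_gt0 : (0 < n)%N.
Hypothesis csa : forall v, selfadjoint_vcond (c v).
Variable b : R.
Hypothesis shortb : forall e : edge G, short b (tau e).
Implicit Types x y z : 'rV[C]_(nodes G n).

Definition end_sample (g : edge G + edge G -> C) : 'rV[C]_(nodes G n) :=
  sample n (fun e i => if i == 0%N then g (inl e) else if i == n then g (inr e) else 0).

Lemma endval_end_sample g h : endval (end_sample g) h = g h.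
Proof.
case: h => e /=; rewrite nval_sample //=.
by rewrite eqxx gtn_eqF.
Qed.

(** Vertex data are free because different ends have different nodes; [0 < n] separates the two ends
    of an edge. *)
Lemma trace_surj (U : forall v : vert G, 'cV[C]_(deg v)) :
  exists y, forall v, trace y v = U v.
Proof.
have h_in (h : edge G + edge G) : h \in ends (end_vert h) by rewrite inE.
pose g h := U (end_vert h) (enum_rank_in (h_in h) h) 0.
have gE v h (hv : h \in ends v) : g h = U v (enum_rank_in hv h) 0.
  have E : end_vert h = v by move: hv; rewrite inE => /eqP.
  by case: v / E hv => hv; rewrite /g (bool_irrelevance (h_in h) hv).
exists (end_sample g) => v; apply/colP => j; rewrite mxE endval_end_sample.
rewrite (gE v _ (enum_valP j)); congr (U v _ 0).
by rewrite enum_valK_in.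
Qed.

(** [lflux] and [rflux] are the derivatives at the left and right end of piece [i] of the solution
    through the nodal values; see [dtn_flux]. *)
Definition lflux k x e i : C :=
  - ((even_dtn k (tau e) / 2)%:C * (nval x e i + nval x e i.+1) +
     (odd_dtn k (tau e) / 2)%:C * (nval x e i - nval x e i.+1)).

Definition rflux k x e i : C :=
  (even_dtn k (tau e) / 2)%:C * (nval x e i + nval x e i.+1) -
  (odd_dtn k (tau e) / 2)%:C * (nval x e i - nval x e i.+1).

(** Summation by parts: a test vector vanishing at the ends sees only the jumps of the derivative at
    interior nodes. *)
Lemma energy_flux k x y : (forall h, endval y h = 0) ->
  energy k x y =
  \sum_e \sum_(i < n.-1) (rflux k x e i - lflux k x e i.+1) * (nval y e i.+1)^*%R.
Proof.
move=> y0; apply: eq_bigr => e _.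
have yl : nval y e 0 = 0 := y0 (inl e).
have yr : nval y e n = 0 := y0 (inr e).
transitivity (\sum_(i < n) (- lflux k x e i) * (nval y e i)^*%R +
              \sum_(i < n) rflux k x e i * (nval y e i.+1)^*%R).
  rewrite -big_split /=; apply: eq_bigr => i _.
  by rewrite /lflux /rflux opprK rmorphD rmorphB /=; ring.
have sumL (F : nat -> C) : \sum_(i < n) F i = F 0%N + \sum_(i < n.-1) F i.+1.
  by case: (n) n_gt0 => // m _; rewrite big_ord_recl.
have sumR (F : nat -> C) : \sum_(i < n) F i = \sum_(i < n.-1) F i + F n.-1.
  by case: (n) n_gt0 => // m _; rewrite big_ord_recr.
rewrite (sumL (fun i => - lflux k x e i * (nval y e i)^*%R)).
rewrite (sumR (fun i => rflux k x e i * (nval y e i.+1)^*%R)) prednK // yl yr.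
rewrite rmorph0 !mulr0 add0r addr0 -big_split /=; apply: eq_bigr => i _.
by ring.
Qed.

Lemma flux_continuous k x : (forall z, admissible c z -> gform c k x z = 0) ->
  forall e i, (i.+1 < n)%N -> rflux k x e i = lflux k x e i.+1.
Proof.
move=> xk e i ilt.
(* Testing against the jumps of the derivative at the interior nodes. *)
pose y := sample n (fun e i => if (i == 0%N) || (i == n) then 0
  else rflux k x e i.-1 - lflux k x e i).
have y0 h : endval y h = 0.
  by case: h => e' /=; rewrite nval_sample //= eqxx ?orbT.
have tr0 v : trace y v = 0 by apply/colP => j; rewrite !mxE y0.
have ya : admissible c y by move=> v; rewrite tr0 mulmx0.
have := xk y ya; rewrite /gform (energy_flux k x y0) /vform.
rewrite [X in _ + X]big1 => [|v _]; last first.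
  by rewrite tr0 trmx0 map_mx0 !mul0mx mxE.
rewrite addr0 => S0.
have yE e' (j : 'I_n.-1) : nval y e' j.+1 = rflux k x e' j - lflux k x e' j.+1.
  have jn : (j.+1 < n)%N by rewrite -ltn_predRL.
  by rewrite nval_sample ?(ltnW jn) //= ltn_eqF.
have S0' : \sum_e' \sum_(j < n.-1) csq (rflux k x e' j - lflux k x e' j.+1) = 0.
  apply: (@complexI R); rewrite -[RHS]S0 rmorph_sum; apply: eq_bigr => e' _ /=.
  by rewrite rmorph_sum; apply: eq_bigr => j _ /=; rewrite csqE yE.
have Se := psumr_eq0P (fun e' _ => sumr_ge0 _ (fun (j : 'I_n.-1) _ => csq_ge0 _)) S0'.
have ip : (i < n.-1)%N by rewrite ltn_predRL.
have Si := psumr_eq0P (fun (j : 'I_n.-1) _ => csq_ge0 _) (Se e isT).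
have /eqP := Si (Ordinal ip) isT.
by rewrite csq_eq0 subr_eq0 => /eqP.
Qed.

Lemma nodal_solution k x : k <= b -> (forall z, admissible c z -> gform c k x z = 0) ->
  forall e i, (i <= n)%N -> nval x e i = sol k (nval x e 0) (lflux k x e 0) (point e i).
Proof.
move=> kb xk e.
have st := short_le kb (shortb e); have t0 := addr_ge0 (ltW st.1) (ltW st.1).
have step i : nval x e i = sol k (nval x e 0) (lflux k x e 0) (point e i) ->
    lflux k x e i = sol' k (nval x e 0) (lflux k x e 0) (point e i) ->
    nval x e i.+1 = sol k (nval x e 0) (lflux k x e 0) (point e i.+1) /\
    rflux k x e i = sol' k (nval x e 0) (lflux k x e 0) (point e i.+1).
  move=> xE lE; have [x1 r1] := dtn_flux (nval x e i) (nval x e i.+1) st.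
  rewrite /rflux r1 [LHS]x1 -/(lflux k x e i) pointS.
  by have [-> ->] := sol_shift k (nval x e 0) (lflux k x e 0) (point e i) t0; rewrite -xE -lE.
have main i : (i < n)%N -> nval x e i = sol k (nval x e 0) (lflux k x e 0) (point e i) /\
    lflux k x e i = sol' k (nval x e 0) (lflux k x e 0) (point e i).
  elim: i => [|i IH] ilt; first by rewrite point0 sol0 sol'0.
  have [xE lE] := IH (ltnW ilt); have [-> rE] := step i xE lE.
  by rewrite -(flux_continuous xk e ilt).
(* The last node takes one more [step] from [n.-1]: at [n], [lflux] would refer to a node beyond the
   edge. *)
move=> i; rewrite leq_eqVlt => /predU1P[->|/main[//]].
have pn : (n.-1 < n)%N by rewrite prednK.
by have [xE lE] := main _ pn; have := step _ xE lE; rewrite prednK // => -[].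
Qed.

Lemma nodal_solution_vsat k x (f f1 : gfun G)
    (w := fun v => cL (c v) *m bvec f v - bvec' f1 v) :
  admissible c x -> (forall h, endval x h = bval f h) ->
  (forall y, gform c k x y = \sum_v ((trace y v)^t* *m w v) 0 0) ->
  (forall z, admissible c z -> gform c k x z = 0) ->
  forall v, vsat (c v) (bvec f v) (bvec' f1 v).
Proof.
move=> xa xf gE xk.
(* A test vector with the projected defect as its trace turns the weak equation into a vanishing sum
   of squares. *)
pose u v := (1%:M - cD (c v)) *m w v.
have [y yE] := trace_surj u.
have ya : admissible c y by move=> v; rewrite yE; exact: defect_admissible.
have S0 : \sum_v sqnorm ((u v)^t* ) = 0.
  apply: (@complexI R); rewrite -[RHS](xk y ya) gE rmorph_sum; apply: eq_bigr => v _ /=.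
  by rewrite yE /u defect_sqnorm.
move=> v; apply: vsatP => //; first by rewrite -(trace_bvec v xf) xa.
have Sv := psumr_eq0P (fun v _ => sqnorm_ge0 ((u v)^t* )) S0.
have /eqP := Sv v isT.
move=> E; have : (u v)^t* = 0.
  by apply: contraTeq E => /sqnorm_gt0; rewrite lt0r => /andP[].
by move=> /(congr1 (fun M => M^t* )); rewrite trmxCK trmx0 map_mx0.
Qed.

End KernelSolutions.

(** * Multiplicities as kernel dimensions *)

Section EigenspaceDimension.
Variables (R : realType) (G : metric_graph R) (n : nat).
Variable c : forall v : vert G, vcond R (deg v).
Local Notation C := R[i].
Local Notation tau := (halfstep n).
Local Notation point := (point n).
Hypothesis n_gt0 : (0 < n)%N.
Hypothesis csa : forall v, selfadjoint_vcond (c v).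
Variable b : R.
Hypothesis shortb : forall e : edge G, short b (tau e).

Lemma cL_sa v : (cL (c v))^t* = cL (c v).
Proof. exact: cL_herm (csa v). Qed.

Lemma sol_sum m k (a al be : 'I_m -> C) t :
  \sum_i a i * sol k (al i) (be i) t = sol k (\sum_i a i * al i) (\sum_i a i * be i) t.
Proof.
rewrite /sol /lincomb !mulr_suml -big_split /=; apply: eq_bigr => i _; ring.
Qed.

Lemma row_free_kernel m p (Y : 'M[C]_(m, p)) :
  (forall a : 'rV_m, a *m Y = 0 -> a = 0) -> row_free Y.
Proof.
move=> Yi; rewrite -kermx_eq0; apply/rowV0P => v /sub_kermxP; exact: Yi.
Qed.

Lemma row_sum m p (a : 'rV[C]_m) (X : 'M[C]_(m, p)) : a *m X = \sum_i a 0 i *: row i X.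
Proof. exact: mulmx_sum_row. Qed.

Lemma nval_sum m (a : 'I_m -> C) (x : 'I_m -> 'rV[C]_(nodes G n)) e i :
  nval (\sum_j a j *: x j) e i = \sum_j a j * nval (x j) e i.
Proof. by rewrite /nval summxE; apply: eq_bigr => j _; rewrite mxE. Qed.

Lemma aeE (P : R -> Prop) : (forall x, P x) -> \forall x \ae (@lebesgue_measure R), P x.
Proof. by move=> Px; apply: aeW. Qed.

Lemma sinm_step_neq0 k (e : edge G) : k <= b -> sinm k (tau e + tau e) != 0.
Proof.
move=> kb; have [_ E _ _] := dtn_step (short_le kb (shortb e)).
by apply: contra_eq_neq E => ->; rewrite mulr0 eq_sym oppr_eq0 oner_eq0.
Qed.

Lemma eigenspace_rank k m : k <= b -> eigenspace_dim_ge c k m ->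
  (m <= \rank (kermx (gmx n c k)))%N.
Proof.
move=> kb [phi [phiE phiI]].
have /choice[f1 fP] : forall i, exists f1 : gfun G,
    (forall e t, t \in `[0, len e] -> phi i e t = sol k (phi i e 0) (f1 e 0) t /\
                                      f1 e t = sol' k (phi i e 0) (f1 e 0) t) /\
    (forall v, vsat (c v) (bvec (phi i) v) (bvec' f1 v)).
  move=> i; have [f1 [f2 [fH fv fae]]] := phiE i.
  by exists f1; split=> // e t tl; apply: (H2_wave (len_gt0 e) (fH e) (fae e)).
pose X : 'M[C]_(m, nodes G n) := \matrix_i sample n (fun e j => phi i e (point e j)).
have XE i e j : (j <= n)%N -> nval (row i X) e j = phi i e (point e j).
  by move=> jn; rewrite rowK nval_sample.
have Xb i h : endval (row i X) h = bval (phi i) h.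
  by case: h => e /=; rewrite XE // ?point0 ?point_len.
have Xa i : admissible c (row i X).
  move=> v; rewrite (trace_bvec v (Xb i)).
  by have [_ /(_ v)[]] := fP i.
have [Y XY] : exists Y, X = Y *m dom_basis n c.
  by apply/submxP/row_subP => i; apply/dom_basisP; exact: Xa.
have YA : Y *m gmx n c k = 0.
  apply/row_matrixP => i; rewrite row0 row_mul; apply/(gmx_kerP cL_sa) => z za.
  rewrite -row_mul -XY.
  have [fE fv] := fP i; rewrite (gform_sol c n_gt0 shortb z kb fE (XE i)).
  rewrite big1 // => v _; have zv := za v.
  by rewrite (vsat_orth (csa v) (fv v) zv) mxE.
have Yf : row_free Y.
  apply: row_free_kernel => a aY; apply/rowP => i; rewrite [RHS]mxE.
  apply: phiI => e; apply: aeE => t tl.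
  have aX : \sum_j a 0 j *: row j X = 0 by rewrite -row_sum XY mulmxA aY mul0mx.
  pose al := \sum_j a 0 j * phi j e 0; pose be := \sum_j a 0 j * f1 j e 0.
  have sE s : s \in `[0, len e] -> \sum_j a 0 j * phi j e s = sol k al be s.
    move=> sl; rewrite -sol_sum; apply: eq_bigr => j _.
    by have [fE _] := fP j; rewrite (fE e s sl).1.
  have node0 j : (j <= n)%N -> sol k al be (point e j) = 0.
    move=> jn; rewrite -sE ?(point_in n_gt0 shortb) //.
    have := congr1 (fun x => nval x e j) aX; rewrite nval_sum.
    under eq_bigr do rewrite XE //.
    by move=> ->; rewrite /nval mxE.
  (* Nodes 0 and 1 already fix the Cauchy data, since [sinm] does not vanish at the length of a
     short piece. *)
  have al0 : al = 0 by have := node0 0%N isT; rewrite point0 sol0.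
  have be0 : be = 0.
    have := node0 1%N n_gt0; rewrite pointS point0 add0r al0 /sol /lincomb mul0r add0r.
    by move/eqP; rewrite mulf_eq0 fmorph_eq0 (negPf (sinm_step_neq0 e kb)) orbF => /eqP.
  by rewrite sE // al0 be0 /sol /lincomb !mul0r addr0.
by rewrite -(eqP Yf) mxrankS //; apply/sub_kermxP.
Qed.

Lemma row_free_sub m p q (Z : 'M[C]_(p, q)) : (m <= \rank Z)%N ->
  exists2 Y : 'M[C]_(m, q), row_free Y & (Y <= Z)%MS.
Proof.
move=> mZ; exists (pid_mx m *m row_base Z).
  by rewrite /row_free mxrankMfree ?row_base_free // rank_pid_mx.
by rewrite (submx_trans (submxMl _ _)) // eq_row_base.
Qed.

Lemma rank_eigenspace k m : k <= b -> (m <= \rank (kermx (gmx n c k)))%N ->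
  eigenspace_dim_ge c k m.
Proof.
move=> kb /row_free_sub[Y Yf /sub_kermxP YA].
pose x i := row i Y *m dom_basis n c.
have xk i z : admissible c z -> gform c k (x i) z = 0.
  by move=> za; apply: (gmx_kerP cL_sa k (row i Y)).1 za; rewrite -row_mul YA row0.
pose al i e := nval (x i) e 0; pose be i e := lflux k (x i) e 0.
have xE i e j : (j <= n)%N -> nval (x i) e j = sol k (al i e) (be i e) (point e j).
  exact: (nodal_solution n_gt0 shortb kb (xk i)).
pose f1 i : gfun G := fun e => sol' k (al i e) (be i e).
exists (fun i e => sol k (al i e) (be i e)); split=> [i|a a0].
  exists (f1 i), (fun e => lincomb (fun x => - k * cosm k x) (fun x => - k * sinm k x)
                                   (al i e) (be i e)); split.
  - by move=> e; exact: wave_H2.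
  - have xb h : endval (x i) h = bval (fun e => sol k (al i e) (be i e)) h.
      by case: h => e /=; rewrite xE // ?point0 ?point_len.
    have gE y := gform_sol c n_gt0 shortb (f := fun e => sol k (al i e) (be i e))
      (f1 := f1 i) (x := x i) y kb.
    apply: (nodal_solution_vsat n_gt0 csa (admissible_basis _) xb _ (xk i)) => y.
    apply: gE => [e t _|]; last exact: xE.
    by rewrite /= sol0 /f1 sol'0; split.
  - move=> e; apply: aeE => t _; rewrite /sol /lincomb.
    by ring.
have aY : (\row_i a i) *m Y = 0.
  have Bf : row_free (dom_basis n c).
    by rewrite /row_free mxrank_unitary // dom_basis_unitary.
  apply: (row_free_inj Bf); rewrite mul0mx -mulmxA row_sum; apply: nval_eq => e j jn.
  rewrite nval_sum {2}/nval mxE.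
  under eq_bigr do rewrite mxE row_mul xE //.
  rewrite sol_sum; apply: (lincomb_ae0 (len_gt0 e)); last exact: (point_in n_gt0 shortb).
  move: (a0 e); apply: filterS; first exact: (ae_filter_ringOfSetsType (@lebesgue_measure R)).
  by move=> t tE /tE; rewrite sol_sum.
move: aY; rewrite -[X in _ = X](mul0mx 1 Y) => /(row_free_inj Yf) /rowP aE i.
by have := aE i; rewrite !mxE.
Qed.

End EigenspaceDimension.

(** * From multiplicities to subspaces and back *)

Section Counting.
Variables (R : realType) (G : metric_graph R) (n : nat).
Variable c : forall v : vert G, vcond R (deg v).
Local Notation C := R[i].
Hypothesis n_gt0 : (0 < n)%N.
Hypothesis csa : forall v, selfadjoint_vcond (c v).
Variable b : R.
Hypothesis shortb : forall e : edge G, short b (halfstep n e).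

Let Bf : row_free (dom_basis n c).
Proof. by rewrite /row_free mxrank_unitary // dom_basis_unitary. Qed.

Lemma nonpositive_space K (m : 'I_K -> R) : (forall j, m j < b) ->
  (forall k, eigenspace_dim_ge c k #|[set j | m j == k]%SET|) ->
  exists2 X : 'M[C]_(\rank (dom_mx n c), nodes G n), (K <= \rank X)%N &
    forall x : 'rV[C]_(nodes G n), (x <= X)%MS ->
      admissible c x /\ genergy b x + gvform c x <= 0.
Proof.
move=> mb mE.
(* At the level [t = b] every index counts, by the strict bound [mb]. *)
have [||k mk|W rW Wneg] := @negative_space R _ (gmx n c) b K m _ _ _ b (lexx b).
- by move=> k; apply: gmx_herm; exact: cL_sa.
- move=> k l y kl lb y0; rewrite !(hform_gmx (cL_sa csa)) ltrD2r.
  apply: (genergy_lt n_gt0 shortb kl lb).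
  by apply: contra y0 => /eqP yB; apply/eqP/(row_free_inj Bf); rewrite yB mul0mx.
- exact: (eigenspace_rank n_gt0 csa shortb (ltW mk)).
exists (W *m dom_basis n c).
  rewrite mxrankMfree // (leq_trans _ rW) // -[leqLHS]card_ord.
  by rewrite subset_leq_card //; apply/fintype.subsetP => j _; rewrite inE mb.
move=> x /submxP[u ->]; rewrite mulmxA; split; first exact: admissible_basis.
rewrite -(hform_gmx (cL_sa csa)).
have [->|uW] := eqVneq (u *m W) 0; first by rewrite /hform !mul0mx mxE.
by rewrite ltW // Wneg // submxMl.
Qed.

Lemma eigenvalues_le K p (X : 'M[C]_(p, nodes G n)) : (K <= \rank X)%N ->
  (forall x : 'rV[C]_(nodes G n), (x <= X)%MS ->
      admissible c x /\ genergy b x + gvform c x <= 0) ->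
  exists m : 'I_K -> R, (forall j, m j <= b) /\
    forall k, eigenspace_dim_ge c k #|[set j | m j == k]%SET|.
Proof.
move=> KX XP.
have [W XW] : exists W, X = W *m dom_basis n c.
  by apply/submxP/row_subP => i; apply/dom_basisP; apply: (XP _ (row_sub i X)).1.
have [a ab aP] := gform_coercive n_gt0 (cL_sa csa) b (fun e => (shortb e).1).
have y0B (y : 'rV_(\rank (dom_mx n c))) : y != 0 -> y *m dom_basis n c != 0.
  move=> y0; apply: contra y0 => /eqP yB; apply/eqP/(row_free_inj Bf).
  by rewrite yB mul0mx.
have [||||m [mb mP]] := @spectral_flow R _ (gmx n c) a b
    (\sum_(e : edge G) 8 * halfstep n e) K _ W ab (gmx_herm n (cL_sa csa)).
- move=> k l y kb lb; rewrite !(hform_gmx (cL_sa csa)).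
  rewrite -(sqnorm_unitary y (dom_basis_unitary n c)).
  have := genergy_lipschitz n_gt0 shortb (y *m dom_basis n c) kb lb.
  by lra.
- by move=> y y0; rewrite (hform_gmx (cL_sa csa)) aP // y0B.
- by rewrite (leq_trans KX) // XW mxrankM_maxl.
- move=> y /submxP[u ->]; rewrite (hform_gmx (cL_sa csa)) -mulmxA -XW.
  by apply: (XP _ (submxMl _ _)).2.
exists m; split=> // k; have [kb|bk] := leP k b.
  exact: (rank_eigenspace n_gt0 csa shortb kb (mP k)).
(* Beyond [b] no [m j] equals [k], and the empty family suffices. *)
rewrite (_ : #|_| = 0%N); first by exists (fun _ _ _ => 0); split=> [[]|a0 _ []].
apply/eqP; rewrite cards_eq0; apply/eqP/setP => j; rewrite !inE.
by apply/negP => /eqP mk; have := mb j; rewrite mk leNgt bk.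
Qed.

End Counting.

Lemma eigenvalue_seq_dim (R : realType) (G : metric_graph R)
    (c : forall v : vert G, vcond R (deg v)) lam : eigenvalue_seq c lam ->
  forall K k, eigenspace_dim_ge c k #|[set j : 'I_K | lam j == k]%SET|.
Proof.
move=> [_ lamP] K k; apply/lamP.
exists (fun i => val (enum_val i)); split=> [i j /val_inj/enum_val_inj//|i].
by have := enum_valP i; rewrite inE => /eqP.
Qed.

(** Pigeonhole: the [k.+1] indices of [m] inject into indices where [lam] takes the same value; if
    [lam k] exceeded [t], these would all be below [k]. *)
Lemma eigenvalue_seq_le (R : realType) (G : metric_graph R)
    (c : forall v : vert G, vcond R (deg v)) lam k t (m : 'I_k.+1 -> R) :
  eigenvalue_seq c lam -> (forall j, m j <= t) ->
  (forall l, eigenspace_dim_ge c l #|[set j | m j == l]%SET|) -> lam k <= t.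
Proof.
move=> [mono lamP] mt mdim.
(* One injection for each value [l]; they glue because [lam] recovers the value from the index. *)
have /choice[F FP] : forall l, exists f : 'I_k.+1 -> nat,
    {in [set j | m j == l]%SET &, injective f} /\ forall j, m j = l -> lam (f j) = l.
  move=> l; have /lamP[s [sinj sl]] := mdim l.
  have [[j0 mj0]|none] := pselect (exists j0, m j0 = l); last first.
    exists (fun=> 0%N); split=> [i j|j mj]; last by case: none; exists j.
    by rewrite inE => /eqP mi; case: none; exists i.
  have j0in : j0 \in [set j | m j == l]%SET by rewrite inE mj0.
  exists (fun j => s (enum_rank_in j0in j)); split=> [i j il jl /sinj|j _]; last exact: sl.
  exact: enum_rank_in_inj.
rewrite leNgt; apply/negP => tk.
have Sk j : (F (m j) j < k)%N.
  rewrite ltnNge; apply/negP => /mono; rewrite leNgt => /negP; apply.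
  by have [_ ->] := FP (m j) => //; exact: le_lt_trans (mt j) tk.
have Sinj : injective (fun j => Ordinal (Sk j)).
  move=> i j /(congr1 val) /= Fij.
  have [_ Li] := FP (m i); have [_ Lj] := FP (m j).
  have mij : m i = m j by rewrite -(Li i erefl) -(Lj j erefl) Fij.
  have [inj _] := FP (m j); apply: inj; rewrite ?inE ?mij //.
  by rewrite -Fij mij.
by have := leq_card _ Sinj; rewrite !card_ord ltnn.
Qed.

(** * Extension by zero to the new edge *)

Section VertexTypes.
Variable R : realType.
Local Notation C := R[i].

(* On the form domain, the boundary form at a vertex of type [t] depends only on
   the sum of the boundary values and on the sum of their squared moduli, so
   that additional zero boundary values do not change it. *)
Definition vtype_val (t : vtype R) (s : C) (q : R) : R :=
  match t with
  | TypeIIa => 0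
  | TypeIIb beta _ => csq s / beta
  | TypeIIIa a _ => a * q
  end.

Lemma hform_trC d (M : 'M[C]_d) (u : 'cV[C]_d) :
  hform M (u^t* ) = complex.Re (\sum_i (u i 0)^*%R * (M *m u) i 0).
Proof.
rewrite /hform trmxCK -mulmxA mxE; congr complex.Re; apply: eq_bigr => i _.
by rewrite !mxE.
Qed.

(** For type II(b), the factor [1 / d] of the projection cancels the [d] in the constant [d / beta];
    for type III(a), the values sum to zero, so [Qmx d] acts as the identity. *)
Lemma vtype_form t d (u : 'cV[C]_d) : cD (vtype_cond t d) *m u = 0 ->
  hform (cL (vtype_cond t d)) (u^t* ) = vtype_val t (\sum_j u j 0) (\sum_j csq (u j 0)).
Proof.
rewrite hform_trC; case: t => [|beta b0|a a0] /=.
- by move=> _; rewrite mul0mx big1 // => i _; rewrite mxE mulr0.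
- move=> _; case: d u => [|d] u; first by rewrite !big_ord0 /csq /= expr0n addr0 mul0r.
  under eq_bigr do rewrite -scalemxAl mxE Pmx_mul.
  rewrite -mulr_suml -rmorph_sum /=; set s := \sum_j _.
  have d0 : (d.+1%:R : R) != 0 by rewrite pnatr_eq0.
  have -> : s^*%R * (((d.+1%:R : R) / beta)%:C * (GRing.inv (d.+1%:R : C) * s)) =
      (csq s / beta)%:C.
    have -> : GRing.inv (d.+1%:R : C) = (GRing.inv (d.+1%:R : R))%:C.
      by rewrite fmorphV rmorph_nat.
    have -> : csq s / beta = (d.+1%:R : R) / beta / d.+1%:R * csq s.
      by rewrite [_ / beta / _]mulrAC divff // mul1r mulrC.
    by rewrite !(rmorphM (real_complex R)) /= csqE; ring.
  by [].
move=> /Pmx_eq0 s0; rewrite mulr_sumr Re_sum; apply: eq_bigr => i _.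
rewrite -scalemxAl mxE Qmx_mul s0 mulr0 subr0 mulrCA (mulrC _^*%R) -csqE.
by rewrite -rmorphM.
Qed.

Lemma vtype_adm t d e (u : 'cV[C]_d) (w : 'cV[C]_e) :
  \sum_j u j 0 = \sum_j w j 0 -> cD (vtype_cond t d) *m u = 0 ->
  cD (vtype_cond t e) *m w = 0.
Proof.
by case: t => [|? ?|? ?] /= uw; rewrite ?mul0mx // => /Pmx_eq0 u0; apply/Pmx_eq0; rewrite -uw.
Qed.

Lemma cast_selfadjoint d e (E : d = e) (k : vcond R d) :
  selfadjoint_vcond k -> selfadjoint_vcond (cast_vcond E k).
Proof.
case: _ / E; rewrite /cast_vcond !castmx_id; by case: k.
Qed.

Lemma cast_adm d e (E : d = e) (k : vcond R d) (u : 'cV[C]_d) : cD k *m u = 0 ->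
  cD (cast_vcond E k) *m castmx (E, erefl 1%N) u = 0.
Proof. by case: _ / E; rewrite /cast_vcond /= !castmx_id. Qed.

Lemma cast_hform d e (E : d = e) (k : vcond R d) (u : 'cV[C]_d) :
  hform (cL (cast_vcond E k)) ((castmx (E, erefl 1%N) u)^t* ) = hform (cL k) (u^t* ).
Proof. by case: _ / E; rewrite /cast_vcond /= !castmx_id. Qed.

End VertexTypes.

Section ZeroExtension.
Variables (R : realType) (G : metric_graph R) (v1 v2 : vert G) (l : R) (l_gt0 : 0 < l).
Variable n : nat.
Local Notation C := R[i].
Local Notation G' := (add_edge v1 v2 l_gt0).
Implicit Types x : 'rV[C]_(nodes G n).

Definition ext x : 'rV[C]_(nodes G' n) :=
  sample n (fun (o : edge G') i => if o is Some e then nval x e i else 0).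

Lemma nval_ext_Some x (e : edge G) i : (i <= n)%N ->
  nval (ext x) (Some e : edge G') i = nval x e i.
Proof. by move=> ile; rewrite nval_sample. Qed.

Lemma nval_ext_None x i : (i <= n)%N -> nval (ext x) (None : edge G') i = 0.
Proof. by move=> ile; rewrite nval_sample. Qed.

Lemma endval_lift x h : endval (ext x) (lift_end v1 v2 l_gt0 h) = endval x h.
Proof. by case: h => e /=; rewrite nval_ext_Some. Qed.

(** Matrix form of the linear map [ext], to transport row spaces. *)
Definition ext_mx : 'M[C]_(nodes G n, nodes G' n) := \matrix_p ext (delta_mx 0 p).

Lemma mul_ext_mx x : x *m ext_mx = ext x.
Proof.
rewrite row_sum; apply: nval_eq => o i ile; rewrite nval_sum.
case: o => [e|]; last first.
  by rewrite nval_ext_None // big1 // => p _; rewrite rowK nval_ext_None // mulr0.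
rewrite nval_ext_Some // [in RHS](row_sum_delta x) nval_sum.
by apply: eq_bigr => p _; rewrite rowK nval_ext_Some.
Qed.

Lemma ext_inj x : ext x = 0 -> x = 0.
Proof.
move=> x0; apply: nval_eq => e i ile.
by rewrite -nval_ext_Some // x0 /nval !mxE.
Qed.

Lemma big_option (V : nmodType) (T : finType) (P : pred (option T)) (F : option T -> V) :
  \sum_(o | P o) F o = (if P None then F None else 0) + \sum_(e | P (Some e)) F (Some e).
Proof.
have -> : index_enum (option T) = None :: map Some (index_enum T).
  rewrite ![index_enum _]unlock.
  by rewrite [in LHS]unlock.
by rewrite big_cons big_map; case: ifP => // _; rewrite add0r.
Qed.

Lemma genergy_ext k x : genergy k (ext x) = genergy k x.
Proof.
rewrite /genergy big_option /= big1 ?add0r => [|i _]; last first.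
  have i1 : (i <= n)%N by exact: ltnW.
  by rewrite !nval_ext_None // addr0 subrr /csq /= expr0n addr0 !mulr0 addr0.
apply: eq_bigr => e _; apply: eq_bigr => i _.
by rewrite !nval_ext_Some // ltnW.
Qed.

(** Sums over ends avoid matching the enumerations at [v1] and [v2], where the new ends shift the
    indices; [F 0 = 0] removes the new terms. *)
Lemma sum_trace_ext (V : nmodType) (F : C -> V) x (v : vert G) : F 0 = 0 ->
  \sum_(j < @deg R G' v) F (@trace R G' n (ext x) v j 0) =
  \sum_(j < deg v) F (trace x v j 0).
Proof.
move=> F0.
have sumE (H : metric_graph R) (w : vert H) (y : 'rV[C]_(nodes H n)) :
    \sum_(j < deg w) F (trace y w j 0) =
    \sum_(e | init e == w) F (nval y e 0) + \sum_(e | term e == w) F (nval y e n).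
  under eq_bigr do rewrite mxE.
  rewrite /deg -(big_enum_val (fun h => F (endval y h))) /=.
  under eq_bigl do rewrite inE.
  by rewrite big_sumType.
rewrite !sumE !big_option /= !nval_ext_None // F0 !if_same !add0r.
by congr (_ + _); apply: eq_bigr => e _; rewrite nval_ext_Some.
Qed.

Variable c : forall v : vert G, vcond R (deg v).
Variable c' : forall v : vert G', vcond R (deg v).
Variables t1 t2 : vtype R.
Hypothesis c1 : c v1 = vtype_cond t1 (deg v1).
Hypothesis c2 : c v2 = vtype_cond t2 (deg v2).
Hypothesis c'E : forall (v : vert G) (n1 : v != v1) (n2 : v != v2),
     c' v = cast_vcond (deg_add_edge l_gt0 n1 n2) (c v).
Hypothesis c'1 : c' v1 = vtype_cond t1 (deg (v1 : vert G')).
Hypothesis c'2 : c' v2 = vtype_cond t2 (deg (v2 : vert G')).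

Lemma ext_vertex x (v : vert G) : cD (c v) *m trace x v = 0 ->
  cD (c' v) *m @trace R G' n (ext x) v = 0 /\
  hform (cL (c' v)) ((@trace R G' n (ext x) v)^t* ) = hform (cL (c v)) ((trace x v)^t* ).
Proof.
have special (w : vert G) t : c w = vtype_cond t (deg w) ->
    c' w = vtype_cond t (deg (w : vert G')) ->
    cD (c w) *m trace x w = 0 ->
    cD (c' w) *m @trace R G' n (ext x) w = 0 /\
    hform (cL (c' w)) ((@trace R G' n (ext x) w)^t* ) = hform (cL (c w)) ((trace x w)^t* ).
  move=> -> -> D0.
  have s1 := @sum_trace_ext _ id x w erefl.
  have D0' := vtype_adm (esym s1) D0; split=> //.
  rewrite !vtype_form // s1; congr vtype_val.
  by apply: sum_trace_ext; rewrite /csq /= expr0n addr0.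
have [->|n1] := eqVneq v v1; first exact: special c1 c'1.
have [->|n2] := eqVneq v v2; first exact: special c2 c'2.
have -> : @trace R G' n (ext x) v = castmx (deg_add_edge l_gt0 n1 n2, erefl 1%N) (trace x v).
  by apply/colP => j; rewrite castmxE !mxE enum_val_add_edge endval_lift.
by rewrite (c'E n1 n2) => D0; rewrite cast_hform; split=> //; exact: cast_adm.
Qed.

Lemma ext_admissible x : admissible c x -> admissible c' (ext x).
Proof. by move=> xa v; have [] := ext_vertex (xa v). Qed.

Lemma gvform_ext x : admissible c x -> gvform c' (ext x) = gvform c x.
Proof. by move=> xa; apply: eq_bigr => v _; have [_] := ext_vertex (xa v). Qed.

End ZeroExtension.

(** One [n] must serve all edges; taking it above the sum of all [|t| * f e ^+ 2] is enough, as the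
    squared denominator grows faster. *)
Lemma short_subdivision (R : realType) (E : finType) (f : E -> R) t :
  (forall e, 0 < f e) ->
  exists2 n : nat, (0 < n)%N & forall e, short t (f e / (n%:R + n%:R)).
Proof.
move=> f0; pose s := \sum_e `|t| * f e ^+ 2.
have s_ge0 e : `|t| * f e ^+ 2 <= s.
  by rewrite /s (bigD1 e) //= lerDl sumr_ge0 // => e' _; rewrite mulr_ge0 ?sqr_ge0.
have [m sm] : exists m : nat, s <= m%:R.
  by exists (Num.truncn s).+1; exact: ltW (truncnS_gt s).
exists m.+1 => // e.
have m0 : 0 < m.+1%:R :> R by rewrite ltr0n.
split; first by rewrite divr_gt0 ?addr_gt0.
have tf : t * f e ^+ 2 <= m.+1%:R ^+ 2.
  apply: (le_trans (ler_wpM2r (sqr_ge0 _) (ler_norm t))).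
  apply: (le_trans (s_ge0 e)); apply: (le_trans sm).
  have : m%:R <= m.+1%:R :> R by rewrite ler_nat.
  have : 1 <= m.+1%:R :> R by rewrite ler1n.
  by nra.
rewrite expr_div_n mulrA mulr2n -mulr2n -mulrnAl ler_pdivrMr ?exprn_gt0 ?addr_gt0 // mul1r.
by rewrite mulr2n; move: tf; have := sqr_ge0 (m.+1%:R : R); nra.
Qed.

Theorem theorem3p2 (R : realType) (G : metric_graph R) (v1 v2 : vert G)
  (v12 : v1 != v2)
  (c : forall v : vert G, vcond R (deg v))
  (csa : forall v, v != v1 -> v != v2 -> selfadjoint_vcond (c v))
  (t1 t2 : vtype R)
  (c1 : c v1 = vtype_cond t1 (deg v1))
  (c2 : c v2 = vtype_cond t2 (deg v2))
  (l : R) (l_gt0 : 0 < l)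
  (c' : forall v : vert (add_edge v1 v2 l_gt0), vcond R (deg v))
  (c'E : forall (v : vert G) (n1 : v != v1) (n2 : v != v2),
     c' v = cast_vcond (deg_add_edge l_gt0 n1 n2) (c v))
  (c'1 : c' v1 = vtype_cond t1 (deg (v1 : vert (add_edge v1 v2 l_gt0))))
  (c'2 : c' v2 = vtype_cond t2 (deg (v2 : vert (add_edge v1 v2 l_gt0))))
  (lam lam' : nat -> R)
  (lamP : eigenvalue_seq c lam) (lam'P : eigenvalue_seq c' lam') (k : nat) :
  lam' k <= lam k.
Proof.
(* A level strictly between the two: the first [k.+1] eigenvalues of the old operator lie strictly
   below [t], and the new operator will get [k.+1] eigenvalues at most [t], against [t < lam' k]. *)
rewrite leNgt; apply/negP => lt_k; pose t := (lam k + lam' k) / 2.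
have lam_t (j : 'I_k.+1) : lam j < t.
  by have := lamP.1 j k; rewrite -ltnS ltn_ord => /(_ isT); rewrite /t; lra.
have t_lam : t < lam' k by rewrite /t; lra.
have csa_all v : selfadjoint_vcond (c v).
  have [->|n1] := eqVneq v v1; first by rewrite c1; exact: vtype_cond_selfadjoint.
  have [->|n2] := eqVneq v v2; first by rewrite c2; exact: vtype_cond_selfadjoint.
  exact: csa.
have c'sa_all v : selfadjoint_vcond (c' v).
  have [->|n1] := eqVneq v v1; first by rewrite c'1; exact: vtype_cond_selfadjoint.
  have [->|n2] := eqVneq v v2; first by rewrite c'2; exact: vtype_cond_selfadjoint.
  by rewrite c'E; apply: cast_selfadjoint; exact: csa.
(* The subdivision is chosen on the new graph, so that the same [n] is fine enough on the old one,
   whose edges are the [Some e]. *)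
have [n n_gt0 short'] := short_subdivision t (@len_gt0 R (add_edge v1 v2 l_gt0)).
have [X KX XP] := nonpositive_space n_gt0 csa_all (fun e => short' (Some e)) lam_t
  (eigenvalue_seq_dim lamP k.+1).
have [||m [mt mdim]] := @eigenvalues_le _ _ n c' n_gt0 c'sa_all t short' k.+1 _
  (X *m ext_mx v1 v2 l_gt0 n).
- rewrite mxrankMfree // -kermx_eq0; apply/rowV0P => x /sub_kermxP.
  by rewrite mul_ext_mx; exact: ext_inj.
- move=> y /submxP[u ->]; rewrite mulmxA mul_ext_mx.
  have [xa xle] := XP _ (submxMl u X).
  split; first exact: (ext_admissible c1 c2 c'E c'1 c'2 xa).
  by rewrite genergy_ext (gvform_ext c1 c2 c'E c'1 c'2 xa).
by have := eigenvalue_seq_le lam'P mt mdim; rewrite leNgt t_lam.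
Qed.
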